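(* Let $0<\alpha<n$ and $r=\frac{n}{n-\alpha}$. Let $f\in L^1(\mathbb{R}^n)$ with $f\ge0$. Let $\Omega:\mathbb{R}^n\setminus\{0\}\to\mathbb{R}$ be a measurable function such that (1) $\Omega(\lambda x)=\Omega(x)$ for all $\lambda>0$ and $x\in\mathbb{R}^n\setminus\{0\}$; (2) $\int_{\mathbb{S}^{n-1}}\Omega(\theta)\,d\sigma(\theta)=0$; (3) $\Omega$ satisfies the $L^r_\alpha$-Dini condition. Then $$\lim_{\lambda\to 0_+}\lambda^r\, m(\{x\in\mathbb{R}^n:|T_{\Omega,\alpha}f(x)|>\lambda\})=\frac1n\,\|\Omega\|_r^r\,\|f\|_1^r.$$
   Context: $m$ is Lebesgue measure on $\mathbb{R}^n$, $\mathbb{S}^{n-1}$ is the unit sphere of $\mathbb{R}^n$, $\sigma$ is its surface (area) measure, $\|\Omega\|_r=\left(\int_{\mathbb{S}^{n-1}}|\Omega|^r\,d\sigma\right)^{1/r}$, and $\|f\|_1$ is the $L^1(\mathbb{R}^n)$ norm. $L^s_\alpha$-Dini condition ($1\le s\le\infty$, $0<\alpha<n$): a function $\Omega$ on $\mathbb{R}^n\setminus\{0\}$ that is homogeneous of degree zero satisfies the $L^s_\alpha$-Dini condition if (i) $\Omega\in L^s(\mathbb{S}^{n-1})$, and (ii) $\int_0^1\frac{\omega_1(\delta)}{\delta^{1+\alpha}}\,d\delta<\infty$, where $$\omega_1(\delta)=\sup_{\|\rho\|\le\delta}\int_{\mathbb{S}^{n-1}}|\Omega(\rho\theta)-\Omega(\theta)|\,d\sigma(\theta),$$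 the supremum being over rotations $\rho$ of $\mathbb{R}^n$ with $\|\rho\|:=\sup\{|\rho x'-x'|:x'\in\mathbb{S}^{n-1}\}\le\delta$. The fractional integral operator is defined, for almost every $x$, by $$T_{\Omega,\alpha}f(x)=\int\frac{\Omega(x-y)}{|x-y|^{n-\alpha}}f(y)\,dy.$$ *)

(* Defs.v *)
From HB Require Import structures.
From mathcomp Require Export all_boot all_order all_algebra.
From mathcomp Require Export all_classical all_reals all_analysis.
From mathcomp Require Export measurable_realfun.

Set Implicit Arguments.
Unset Strict Implicit.
Unset Printing Implicit Defensive.

Export Order.TTheory GRing.Theory Num.Theory.
Export numFieldNormedType.Exports.

Local Open Scope classical_set_scope.
Local Open Scope ring_scope.

Definition rV_display : measure_display -> measure_display.
Proof. exact. Qed.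

(* Vectors of R^n are row vectors ['rV[R]_n], with the sigma-algebra generated by
   the coordinates; for the Borel sigma-algebra of [R] it is the Borel
   sigma-algebra of R^n. *)
Section rV_measurable.
Context {d} {T : measurableType d} (n : nat).

Let coord (i : 'I_n) (v : 'rV[T]_n) : T := v ord0 i.

Let rV_set0 : g_sigma_preimage coord set0.
Proof. exact: sigma_algebra0. Qed.

Let rV_setC A : g_sigma_preimage coord A -> g_sigma_preimage coord (~` A).
Proof. exact: sigma_algebraC. Qed.

Let rV_bigcup (F : _^nat) : (forall i, g_sigma_preimage coord (F i)) ->
  g_sigma_preimage coord (\bigcup_i (F i)).
Proof. exact: sigma_algebra_bigcup. Qed.

HB.instance Definition _ := @isMeasurable.Build (rV_display d)
  'rV[T]_n (g_sigma_preimage coord) rV_set0 rV_setC rV_bigcup.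

End rV_measurable.

Lemma measurable_coord d (T : measurableType d) n (i : 'I_n) :
  measurable_fun [set: 'rV[T]_n] (fun v : 'rV[T]_n => v ord0 i).
Proof.
move=> _ Y mY; rewrite setTI; apply: sub_sigma_algebra => /=.
rewrite -bigcup_seq/=; exists i => /=; first by rewrite mem_index_enum.
by exists Y => //; rewrite setTI.
Qed.

Lemma measurable_fun_rV d d' (T : measurableType d) (T' : measurableType d')
    n (f : T' -> 'rV[T]_n) :
  (forall i, measurable_fun [set: T'] (fun x => f x ord0 i)) ->
  measurable_fun [set: T'] f.
Proof.
move=> mf _ A mA; rewrite setTI.
suff: @measurable _ 'rV[T]_n `<=` [set B | measurable (f @^-1` B)] by exact.
apply: smallest_sub.
- split=> /=.
  + by rewrite preimage_set0.
  + by move=> B mB; rewrite setTD preimage_setC; exact: measurableC.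
  + by move=> F mF; rewrite preimage_bigcup; exact: bigcupT_measurable.
- move=> B; rewrite -bigcup_seq => -[i _] [C mC <-] /=.
  by rewrite setTI -[X in measurable X]setTI; exact: (mf i).
Qed.

Section lebesgue_borel.
Context {R : realType}.
Local Notation RT := (measurableTypeR R).
Local Notation RV n := ('rV[measurableTypeR R]_n).

Definition rV_cons n (p : RT * RV n) : RV n.+1 :=
  row_mx (const_mx p.1 : RV 1) p.2.

Definition rV_uncons n (v : RV n.+1) : RT * RV n :=
  (v ord0 ord0, \row_j v ord0 (lift ord0 j)).

Lemma rV_consK n : cancel (@rV_cons n) (@rV_uncons n).
Proof.
move=> [x v]; congr pair; rewrite /rV_cons /=.
  by rewrite mxE; case: splitP => // j _; rewrite mxE.
apply/rowP => j; rewrite !mxE; case: splitP => [k|k] /=.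
  by rewrite ord1 /bump leq0n.
by rewrite /bump leq0n !add1n => -[/val_inj ->].
Qed.

Lemma measurable_rV_cons n : measurable_fun [set: RT * RV n] (@rV_cons n).
Proof.
apply: measurable_fun_rV => i; rewrite /rV_cons.
have [j ->|j ->] := @split_ordP 1 n i.
  rewrite [X in measurable_fun _ X](_ : _ = fst) //.
  apply/funext => p; apply: etrans (row_mxEl _ _ _ _) _.
  by rewrite mxE.
rewrite [X in measurable_fun _ X](_ : _ =
  (fun v : RV n => v ord0 j) \o snd).
  exact: (measurableT_comp (measurable_coord j) measurable_snd).
by apply/funext => p; exact: (row_mxEr _ _ _ _).
Qed.

Lemma measurable_rV_uncons n : measurable_fun [set: RV n.+1] (@rV_uncons n).
Proof.
apply: measurable_fun_pair; first exact: measurable_coord.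
apply: measurable_fun_rV => i; under eq_fun do rewrite mxE.
exact: measurable_coord.
Qed.

Section step.
Variables (n : nat) (m : {sigma_finite_measure set RV n -> \bar R}).

Definition lebesgue_step : set (RV n.+1) -> \bar R :=
  pushforward (@lebesgue_measure R \x m)%E (@rV_cons n).

Let step0 : lebesgue_step set0 = 0%E.
Proof. by rewrite /lebesgue_step /pushforward preimage_set0 measure0. Qed.

Let step_ge0 A : (0 <= lebesgue_step A)%E.
Proof. by rewrite /lebesgue_step /pushforward measure_ge0. Qed.

Let step_sigma_additive : semi_sigma_additive lebesgue_step.
Proof.
have mc := @measurable_rV_cons n.
move=> F mF tF mUF; rewrite /lebesgue_step /pushforward preimage_bigcup.
apply: measure_semi_sigma_additive.
- by move=> k; rewrite -[X in measurable X]setTI; exact: mc.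
- apply/trivIsetP => /= i j _ _ ij; rewrite -preimage_setI.
  by move/trivIsetP : tF => /(_ _ _ _ _ ij) ->//; rewrite preimage_set0.
- by rewrite -preimage_bigcup -[X in measurable X]setTI; exact: mc.
Qed.

HB.instance Definition _ := isMeasure.Build _ _ _ lebesgue_step
  step0 step_ge0 step_sigma_additive.

Let step_sigma_finite : sigma_finite setT lebesgue_step.
Proof.
have /sigma_finiteP[F [TF ndF Foo]] := sigma_finiteT (@lebesgue_measure R).
have /sigma_finiteP[G [TG ndG Goo]] := sigma_finiteT m.
exists (fun k => @rV_uncons n @^-1` (F k `*` G k)).
  rewrite -preimage_bigcup (_ : \bigcup_k _ = setT) ?preimage_setT//.
  apply/seteqP; split => // -[x y] _.
  have [j _ Fjx] : (\bigcup_i F i) x by rewrite -TF.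
  have [k _ Gky] : (\bigcup_i G i) y by rewrite -TG.
  exists (maxn j k) => //; split.
  - by move: x Fjx; exact/subsetPset/ndF/leq_maxl.
  - by move: y Gky; exact/subsetPset/ndG/leq_maxr.
move=> k; have [mF Fk] := Foo k; have [mG Gk] := Goo k; split.
  by rewrite -[X in measurable X]setTI; apply: measurable_rV_uncons => //;
    exact: measurableX.
rewrite /lebesgue_step /pushforward -comp_preimage.
rewrite (_ : _ \o _ = id); last by apply/funext => p /=; rewrite rV_consK.
by rewrite preimage_id product_measure1E// lte_mul_pinfty// ge0_fin_numE.
Qed.

HB.instance Definition _ := Measure_isSigmaFinite.Build _ _ _ lebesgue_step
  step_sigma_finite.

End step.

(* The n-fold product of the Lebesgue measure of [R], on Borel sets. *)
Fixpoint lebesgue_borel n : {sigma_finite_measure set (RV n) -> \bar R} :=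
  match n with
  | 0 => \d_(const_mx 0 : RV 0)
  | k.+1 => lebesgue_step (lebesgue_borel k)
  end.

End lebesgue_borel.

(* R^n with the sigma-algebra of Lebesgue measurable sets: those that are
   Caratheodory measurable for the outer measure of [lebesgue_borel]. *)
Definition Rn (R : realType) (n : nat) : measurableType _ :=
  caratheodory_type (mu_ext (@lebesgue_borel R n)).

(* [completed_measure_extension], which also gives the library's
   [completed_lebesgue_measure] on [R], is complete. *)
Definition lebesgueRn (R : realType) (n : nat) :
    {measure set (Rn R n) -> \bar R} :=
  @completed_measure_extension _ _ _ (@lebesgue_borel R n).

(* The norm that the library puts on ['rV[R]_n] is the maximum norm. *)
Definition enorm (R : realType) (n : nat) (x : 'rV[R]_n) : R :=
  Num.sqrt (\sum_(i < n) x ord0 i ^+ 2).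

Definition usphere (R : realType) (n : nat) : set 'rV[R]_n :=
  [set x | enorm x = 1].
Arguments usphere R n : clear implicits.

(* The part of the open unit ball, minus the origin, lying on the open rays
   through the points of [E] of norm 1. *)
Definition sector (R : realType) (n : nat) (E : set 'rV[R]_n) : set 'rV[R]_n :=
  [set x | 0 < enorm x < 1 /\ E ((enorm x)^-1 *: x)].

(* ['rV[R]_n] with the sigma-algebra of the surface measure of the unit sphere:
   [E] is measurable when the sector of [E] is Lebesgue measurable. *)
Definition Sn (R : realType) (n : nat) := 'rV[R]_n.

Definition surface_display : measure_display -> measure_display.
Proof. exact. Qed.

Section surface_measure.
Context {R : realType} (n : nat).
Local Notation measurableL := (@measurable _ (Rn R n)).

Let measurable_enorm :
  measurable_fun [set: 'rV[measurableTypeR R]_n] (@enorm R n : _ -> R).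
Proof.
rewrite /enorm; apply: (measurableT_comp (f := @Num.sqrt R)).
  by apply: continuous_measurable_fun; exact: sqrt_continuous.
apply: measurable_sum => i; apply: (measurable_funX 2).
exact: measurable_coord.
Qed.

Let sector0 : sector set0 = set0 :> set 'rV[R]_n.
Proof. by apply/seteqP; split => // x []. Qed.

Let measurable_sectorT : measurableL (sector setT).
Proof.
apply: caratheodory_measurable_mu_ext.
rewrite (_ : sector setT = setT `&` @enorm R n @^-1` `]0, 1[%classic).
  by apply: measurable_enorm => //; exact: measurable_itv.
by apply/seteqP; split => x /=; rewrite in_itv /=; [case|case].
Qed.

Let sectorC (E : set 'rV[R]_n) : sector (~` E) = sector setT `\` sector E.
Proof.
apply/seteqP; split => [x [x01 nE]|x [[x01 _] nE]].
  by split; [split|case].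
by split => // Ex; apply: nE.
Qed.

Let sector_bigcup (F : (set 'rV[R]_n)^nat) :
  sector (\bigcup_k F k) = \bigcup_k sector (F k).
Proof.
apply/seteqP; split => [x [x01 [k _ Fk]]|x [k _ [x01 Fk]]].
  by exists k.
by split => //; exists k.
Qed.

Let Sn_set0 : measurableL (sector set0).
Proof. by rewrite sector0; exact: measurable0. Qed.

Let Sn_setC (E : set 'rV[R]_n) :
  measurableL (sector E) -> measurableL (sector (~` E)).
Proof. by move=> mE; rewrite sectorC; exact: measurableD. Qed.

Let Sn_bigcup (F : (set 'rV[R]_n)^nat) :
  (forall k, measurableL (sector (F k))) ->
  measurableL (sector (\bigcup_k F k)).
Proof. by move=> mF; rewrite sector_bigcup; exact: bigcupT_measurable. Qed.

HB.instance Definition _ := Pointed.on (Sn R n).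
HB.instance Definition _ := @isMeasurable.Build
  (surface_display default_measure_display) (Sn R n)
  [set E | measurableL (sector E)] Sn_set0 Sn_setC Sn_bigcup.

(* The area of [E] is [n] times the volume of its sector; every set that does
   not meet the unit sphere has area 0. *)
Definition area (E : set (Sn R n)) : \bar R :=
  (n%:R%:E * lebesgueRn R n (sector E))%E.

Let area0 : area set0 = 0%E.
Proof. by rewrite /area sector0 measure0 mule0. Qed.

Let area_ge0 E : (0 <= area E)%E.
Proof. by rewrite /area mule_ge0. Qed.

Let area_sigma_additive : semi_sigma_additive area.
Proof.
move=> F mF tF mUF; rewrite /area sector_bigcup.
rewrite [X in X @ _](_ : _ = fun k =>
    (n%:R%:E * \sum_(0 <= i < k) lebesgueRn R n (sector (F i)))%E); last first.
  by apply/funext => k; rewrite ge0_sume_distrr// => i _; exact: measure_ge0.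
apply: cvgeZl => //; apply: measure_semi_sigma_additive => //.
- apply/trivIsetP => i j _ _ ij; apply/seteqP; split => // x [[_ Fi] [_ Fj]].
  have Fij : (F i `&` F j) ((enorm x)^-1 *: x) by [].
  by move/trivIsetP : tF Fij => /(_ i j I I ij) ->.
- exact: bigcupT_measurable.
Qed.

HB.instance Definition _ := isMeasure.Build _ _ _ area
  area0 area_ge0 area_sigma_additive.

Definition surface_measure : {measure set (Sn R n) -> \bar R} := area.

End surface_measure.
Arguments surface_measure R n : clear implicits.

Section dini.
Context {R : realType} {n : nat}.
Implicit Types (Omega : 'rV[R]_n -> R) (rho : 'M[R]_n).
Local Notation sigma := (surface_measure R n).

(* [rho] acts on row vectors by [x |-> x *m rho]. *)
Definition rotation rho : Prop := rho *m rho^T = 1%:M /\ \det rho = 1.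

Definition rotation_norm rho : \bar R :=
  ereal_sup [set (enorm (x *m rho - x))%:E | x in usphere R n].

Definition omega1 Omega (delta : R) : \bar R :=
  ereal_sup [set (\int[sigma]_(theta in usphere R n)
                    (`|Omega (theta *m rho) - Omega theta|)%:E)%E
            | rho in [set rho | rotation rho /\
                                (rotation_norm rho <= delta%:E)%E]].

Definition Dini (s : \bar R) (alpha : R) Omega : Prop :=
  (Omega : Sn R n -> R) \in Lfun sigma s /\
  (\int[lebesgue_measure]_(delta in `]0%R, 1%R[)
     (omega1 Omega delta * ((delta `^ (1 + alpha))^-1)%:E) < +oo)%E.

(* The integral is total: on the null set of [x] where it does not converge
   absolutely, its value is a convention. *)
Definition frac_integral Omega (alpha : R) (f : 'rV[R]_n -> R) (x : 'rV[R]_n) :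
    \bar R :=
  (\int[lebesgueRn R n]_y
     (Omega (x - y) / enorm (x - y) `^ (n%:R - alpha) * f y)%:E)%E.

End dini.

(* Main.v *)
Require Import Defs.
From mathcomp Require Import ring lra.

(* Write [K x = Omega x / |x|^(n - alpha)] and [c = ||f||_1]. Polar coordinates
   give [m {|K| > u} = u^-r ||Omega||_r^r / n], so it is enough to replace
   [T f = K * f] by [c K] as [lambda -> 0]. With [s^(n - alpha) = lambda], the
   homogeneity of [K] turns [lambda^r m {|T f| > lambda}] into the measure of
   [{x : |\int K (x - s y) f y dy| > 1}]. Split [K] at height [d]: the part with
   [|K| > d] is integrable because [K] is in weak L^r with [r > 1], so by
   continuity of translations in L^1 its contribution to
   [\int K (x - s y) f y dy - c K x] tends to 0 in L^1 as [s -> 0], while the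
   rest contributes at most [2 d c]. Hence the dilated functions tend to [c K]
   in measure, and [u |-> m {|c K| > u}] is continuous at [u = 1]. Since the
   Lebesgue sigma-algebra is completed, Tonelli is applied to Borel versions of
   [K] and [f]. *)

Set Implicit Arguments.
Unset Strict Implicit.
Unset Printing Implicit Defensive.

Local Open Scope classical_set_scope.
Local Open Scope ring_scope.

Local Notation RT R := (measurableTypeR R).
Local Notation RV R n := ('rV[measurableTypeR R]_n).

(** * Affine images and n-dimensional Lebesgue measure *)

(** The identity [(n - alpha) r = n] ties the two scalings together: the dilation by [1 / s]
    multiplies volume by [s^-n], and [lambda^r = s^n] cancels this factor exactly. In general [K] is
    neither integrable nor in L^r, so no norm convergence is available for [K] itself. It is split
    by height rather than by distance to the origin because [Omega] may be unbounded on the sphere.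
    The choices come in a fixed order: a tolerance around the level 1, then [d], then [s]; hence the
    L^1 convergence needs no rate. The sign of [f] makes [\int f] equal to [||f||_1], so the same
    [c] is the factor of the limit and the bound of the error. The polar formula reduces to
    dilations: [{|K| > u}] is the region under a radial graph, and over a set where the graph is
    constant this region is a dilated sector, whose volume is the area up to a factor. Borel
    versions are forced because [(x, y) |-> x - s y] followed by a Lebesgue measurable function need
    not be measurable for the product of the completed sigma-algebras. *)

Lemma lebesgue_measure_affine (R : realType) (a b : R) (A : set R) : a != 0 ->
  measurable (A : set (RT R)) ->
  (`|a|%:E * lebesgue_measure ((fun x => a * x + b)%R @^-1` A) =
   lebesgue_measure A)%E.
Proof.
move=> a0 mA.
pose phi : RT R -> RT R := fun x => a * x + b.
have mphi : measurable_fun setT phi.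
  by apply: measurable_funD => //; exact: mulrl_measurable.
pose mu := mscale (NngNum (normr_ge0 a))
  (measure_function_pushforward__canonical__measure_function_Measure
    (@lebesgue_measure R) mphi).
rewrite [RHS](@lebesgue_measure_unique _ mu) // => _ [[c d] _ <-].
change (lebesgue_measure `]c, d]%classic =
  `|a|%:E * lebesgue_measure (phi @^-1` `]c, d]%classic))%E.
have [a_gt0|a_lt0] : {a > 0} + {a < 0}.
  by case: (ltgtP a 0) a0 => //; [right|left].
- have -> : phi @^-1` `]c, d] = `](c - b) / a, (d - b) / a]%classic.
    apply/seteqP; split => x /=; rewrite !in_itv/= /phi;
      by rewrite ltr_pdivrMr// ler_pdivlMr// ltrBlDr lerBrDr mulrC.
  rewrite !lebesgue_measure_itv/= !lte_fin ltr_pM2r ?invr_gt0// ltrD2r.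
  case: ifPn => _; last by rewrite mule0.
  rewrite gtr0_norm// -!EFinB -EFinM; congr EFin; field; exact: lt0r_neq0.
- have -> : phi @^-1` `]c, d] = `[(d - b) / a, (c - b) / a[%classic.
    apply/seteqP; split => x /=; rewrite !in_itv/= /phi;
      by rewrite ltr_ndivlMr// ler_ndivrMr// ltrBlDr lerBrDr mulrC andbC.
  rewrite !lebesgue_measure_itv/= !lte_fin ltr_nM2r ?invr_lt0// ltrD2r.
  case: ifPn => _; last by rewrite mule0.
  rewrite ltr0_norm// -!EFinB -EFinM; congr EFin; field; exact: ltr0_neq0.
Qed.

Section affine.
Context {R : realType}.

Definition affine n (a : R) (v x : 'rV[R]_n) : 'rV[R]_n := a *: x + v.

Lemma affineK n (a : R) (v : 'rV[R]_n) : a != 0 ->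
  cancel (affine a v) (affine a^-1 (- (a^-1 *: v))).
Proof.
by move=> a0 x; rewrite /affine scalerDr scalerA mulVf// scale1r addrK.
Qed.

Lemma affineVK n (a : R) (v : 'rV[R]_n) : a != 0 ->
  cancel (affine a^-1 (- (a^-1 *: v))) (affine a v).
Proof.
move=> a0 x; rewrite /affine scalerDr scalerA divff// scale1r scalerN scalerA.
by rewrite divff// scale1r subrK.
Qed.

Lemma measurable_affine n (a : R) (v : 'rV[R]_n) :
  measurable_fun [set: RV R n] (affine a v : RV R n -> RV R n).
Proof.
apply: measurable_fun_rV => i; under eq_fun do rewrite !mxE.
apply: measurable_funD => //; apply: measurable_funM => //.
exact: measurable_coord.
Qed.

(** Induction on the dimension: under [rV_cons] the map becomes a product [psi] of two affine maps,
    and the scaled pushforward of the product measure has the right value on rectangles, which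
    determines it. *)
Lemma lebesgue_borel_affine n (a : R) (v : 'rV[R]_n) (A : set 'rV[R]_n) :
  a != 0 -> measurable (A : set (RV R n)) ->
  ((`|a| ^+ n)%:E * lebesgue_borel n (affine a v @^-1` A) =
   lebesgue_borel n A)%E.
Proof.
move=> a0; elim: n v A => [v A mA|n IH v A mA].
  rewrite expr0 mul1e; congr (lebesgue_borel 0 _); apply/funext => x /=.
  by congr A; apply/rowP => -[].
rewrite /= /lebesgue_step /pushforward /=.
pose psi : RT R * RV R n -> RT R * RV R n :=
  fun z => (a * z.1 + v ord0 ord0,
            affine a (\row_j v ord0 (lift ord0 j)) z.2).
have mpsi : measurable_fun setT psi.
  apply: measurable_fun_pair.
    by apply: measurable_funD => //; apply: measurable_funM.
  by apply: measurableT_comp => //; exact: measurable_affine.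
have mA' : measurable (@rV_cons R n @^-1` A).
  by rewrite -[X in measurable X]setTI; exact: measurable_rV_cons.
pose mu := mscale (NngNum (exprn_ge0 n.+1 (normr_ge0 a)))
  (measure_function_pushforward__canonical__measure_function_Measure
    (lebesgue_measure \x lebesgue_borel n)%E mpsi).
rewrite [RHS](@product_measure_unique _ _ _ _ _ _ _ mu) //; last first.
  move=> B C mB mC.
  change ((`|a| ^+ n.+1)%:E *
    (lebesgue_measure \x lebesgue_borel n) (psi @^-1` (B `*` C)) =
    lebesgue_measure B * lebesgue_borel n C)%E.
  rewrite (_ : psi @^-1` _ = (fun x => a * x + v ord0 ord0) @^-1` B `*`
     affine a (\row_j v ord0 (lift ord0 j)) @^-1` C)//.
  rewrite product_measure1E.
  - rewrite -[in RHS](lebesgue_measure_affine (v ord0 ord0) a0)//.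
    by rewrite -[in RHS](IH (\row_j v ord0 (lift ord0 j)))// exprS EFinM muleACA.
  - rewrite -[X in measurable X]setTI.
    suff : measurable_fun [set: RT R]
      ((fun x => a * x + v ord0 ord0) : RT R -> RT R) by exact.
    by apply: measurable_funD => //; exact: mulrl_measurable.
  - rewrite -[X in measurable X]setTI; exact: measurable_affine.
congr (_ * (_ \x _) _)%E; apply/funext => z /=; congr A.
apply/rowP => i; rewrite !mxE.
have [j ->|j ->] := @split_ordP 1 n i; rewrite ?row_mxEl ?row_mxEr !mxE//.
  by rewrite ord1; congr (_ + v _ _); apply/val_inj.
by congr (_ + v _ _); apply/val_inj.
Qed.

End affine.

(** * Lebesgue measure as an outer measure, and approximation by Borel sets *)

Section lebesgueRn_theory.
Context {R : realType} {n : nat}.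
Implicit Types (A B : set 'rV[R]_n).
Local Notation mu := (@lebesgue_borel R n).
Local Notation m := (lebesgueRn R n).
Local Notation mB := (@measurable _ (RV R n)).
Local Notation mL := (@measurable _ (Rn R n)).
Local Open Scope ereal_scope.

Lemma lebesgueRnE A : mB A -> m A = mu A.
Proof. exact: measurable_mu_extE. Qed.

Lemma measurable_RnW A : mB A -> mL A.
Proof. exact: caratheodory_measurable_mu_ext. Qed.

(** As a function on sets, [lebesgueRn] is the outer measure itself, so monotonicity and
    subadditivity hold for arbitrary sets. The level sets of [frac_integral] are handled in this
    way, without proving them measurable. *)
Lemma le_lebesgueRn A B : A `<=` B -> m A <= m B.
Proof. exact: (le_outer_measure (mu_ext mu)). Qed.

Lemma lebesgueRnU2 A B : m (A `|` B) <= m A + m B.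
Proof. exact: (outer_measureU2 (mu_ext mu)). Qed.

Lemma lebesgueRn_null A : m A = 0 -> mL A.
Proof.
move=> A0; apply: le_caratheodory_measurable => X.
change (m (X `&` A) + m (X `&` ~` A) <= m X).
have -> : m (X `&` A) = 0.
  apply/eqP; rewrite eq_le measure_ge0 andbT -A0.
  by apply: le_lebesgueRn; exact: subIsetr.
by rewrite add0e; apply: le_lebesgueRn; exact: subIsetl.
Qed.

(** A Borel cover of [A] pulls back to a Borel cover of the preimage, with measures scaled as in
    [lebesgue_borel_affine]. The same inequality for the inverse map then gives equality. *)
Let lebesgueRn_affine_le (a : R) (v : 'rV[R]_n) A : (a != 0)%R ->
  (`|a| ^+ n)%:E * m (affine a v @^-1` A) <= m A.
Proof.
move=> a0; have an0 : (0 < `|a| ^+ n)%R by rewrite exprn_gt0// normr_gt0.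
apply: le_ereal_inf_tmp => _ [F [mF AF] <-].
have mF' i : mB (affine a v @^-1` F i).
  by rewrite -[X in measurable X]setTI; exact: measurable_affine.
rewrite (eq_eseriesr (fun i _ => esym (lebesgue_borel_affine v a0 (mF i)))).
rewrite nneseriesZl; last by move=> i _; exact: measure_ge0.
apply: lee_wpmul2l; first by rewrite lee_fin ltW.
apply: ereal_inf_lbound; exists (fun i => affine a v @^-1` F i) => //; split=> //.
by rewrite -preimage_bigcup; exact: preimage_subset.
Qed.

Lemma lebesgueRn_affine (a : R) (v : 'rV[R]_n) A : (a != 0)%R ->
  (`|a| ^+ n)%:E * m (affine a v @^-1` A) = m A.
Proof.
move=> a0; have an0 : (0 < `|a| ^+ n)%R by rewrite exprn_gt0// normr_gt0.
apply/eqP; rewrite eq_le lebesgueRn_affine_le//=.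
have a'0 : (a^-1 != 0)%R by rewrite invr_eq0.
have /(lee_wpmul2l (ltW an0 : 0 <= (`|a| ^+ n)%:E)) :=
  lebesgueRn_affine_le (- (a^-1 *: v))%R (affine a v @^-1` A) a'0.
rewrite -comp_preimage (_ : _ \o _ = id); last first.
  by apply/funext => x /=; exact: affineVK.
by rewrite preimage_id muleA -EFinM normfV -exprMn divff ?normr_eq0// expr1n mul1e.
Qed.

(** Caratheodory's criterion is transported: every test set [X] is the preimage of some [Y], and
    after multiplication by [|a|^n] the criterion for [X] becomes the criterion of [A] for [Y]. *)
Lemma measurable_Rn_affine (a : R) (v : 'rV[R]_n) : (a != 0)%R ->
  measurable_fun [set: Rn R n] (affine a v : Rn R n -> Rn R n).
Proof.
move=> a0 _ A mA; rewrite setTI.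
have an0 : (0 < `|a| ^+ n)%R by rewrite exprn_gt0// normr_gt0.
apply: le_caratheodory_measurable => X.
pose Y := affine a^-1 (- (a^-1 *: v)) @^-1` X.
have XY : X = affine a v @^-1` Y.
  by apply/funext => x; rewrite /Y /= affineK.
have XE (B : set 'rV[R]_n) : (`|a| ^+ n)%:E * m (X `&` affine a v @^-1` B) =
    m (Y `&` B).
  by rewrite XY -preimage_setI lebesgueRn_affine.
change (m (X `&` affine a v @^-1` A) + m (X `&` affine a v @^-1` (~` A)) <= m X).
rewrite -(@lee_pmul2l _ (`|a| ^+ n)%:E)// ge0_muleDr ?measure_ge0// !XE.
rewrite -[X]setIT -(preimage_setT (affine a v)) XE setIT.
by rewrite [leRHS](mA Y).
Qed.

Lemma outer_hull A : exists F, [/\ mB F, A `<=` F & mu F = m A].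
Proof.
have [Aoo|Aoo] := eqVneq (m A) +oo.
  exists setT; split => //; rewrite Aoo; apply/eqP; rewrite -leye_eq -Aoo.
  by rewrite -lebesgueRnE//; exact: le_lebesgueRn.
have mfin : m A \is a fin_num by rewrite ge0_fin_numE ?ltey// measure_ge0.
have /choice[F FA] k : exists F, [/\ mB F, A `<=` F & mu F < m A + k.+1%:R^-1%:E].
  have : (0 < k.+1%:R^-1 :> R)%R by rewrite invr_gt0.
  move=> /lb_ereal_inf_adherent /(_ mfin)[_ [F [mF AF] <-] Fk].
  exists (\bigcup_i F i); split => //; first exact: bigcupT_measurable.
  apply: le_lt_trans Fk; apply: measure_sigma_subadditive => //.
  exact: bigcupT_measurable.
have mF : mB (\bigcap_k F k) by apply: bigcapT_measurable => k; have [] := FA k.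
have AF : A `<=` \bigcap_k F k by move=> x Ax k _; have [_ + _] := FA k; apply.
exists (\bigcap_k F k); split => //; apply/eqP; rewrite eq_le -lebesgueRnE//.
apply/andP; split; last exact: le_lebesgueRn.
apply/lee_addgt0Pr => e e0.
near \oo => k; have [mFk _ Fk] := FA k.
apply: (@le_trans _ _ (m (F k))); first by apply: le_lebesgueRn; exact: bigcap_inf.
rewrite lebesgueRnE// (le_trans (ltW Fk))// leeD// lee_fin ltW//.
by near: k; exact: near_infty_natSinv_lt (PosNum e0).
Unshelve. all: by end_near. Qed.

(** Finite measure allows subtraction: a hull [F] of [A] exceeds [A] by a null set, so a hull of
    [F \ A] is a Borel null set outside which [A] and [F] agree. *)
Let borel_approx_fin A : mL A -> m A < +oo ->
  exists B N, [/\ mB B, mB N, mu N = 0 & A `\` N = B `\` N].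
Proof.
move=> mA Afin.
have [F [mF AF muF]] := outer_hull A.
have [G [mG FAG muG]] := outer_hull (F `\` A).
exists F, G; split => //.
  rewrite muG measureD//=; last 2 first.
  - exact: measurable_RnW.
  - by rewrite lebesgueRnE// muF.
  by rewrite setIidr// lebesgueRnE// muF subee// ge0_fin_numE// measure_ge0.
apply/seteqP; split => x [xA xG]; split => //; first exact: AF.
by apply: contrapT => nA; exact/xG/FAG.
Qed.

Lemma borel_approx A : mL A ->
  exists B N, [/\ mB B, mB N, mu N = 0 & A `\` N = B `\` N].
Proof.
move=> mA; have [S ST mS] := sigma_finiteT mu.
have /choice[B /choice[N BN]] k :
    exists B N, [/\ mB B, mB N, mu N = 0 & (A `&` S k) `\` N = B `\` N].
  have [mSk Sk] := mS k; apply: borel_approx_fin.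
    by apply: measurableI => //; exact: measurable_RnW.
  apply: (le_lt_trans (le_lebesgueRn (@subIsetr _ A (S k)))).
  by rewrite lebesgueRnE.
exists (\bigcup_k B k), (\bigcup_k N k).
have mB' k : mB (B k) by have [] := BN k.
have mN k : mB (N k) by have [] := BN k.
split; try exact: bigcupT_measurable.
  apply/eqP; rewrite eq_le measure_ge0 andbT.
  have N0 k : mu (N k) = 0 by have [] := BN k.
  have -> : 0 = \sum_(0 <= k <oo) mu (N k) by rewrite eseries0.
  by apply: measure_sigma_subadditive => //; exact: bigcupT_measurable.
apply/seteqP; split => x [xA xN]; split => //.
- have : (\bigcup_i S i) x by rewrite -ST.
  move=> [k _ Skx]; exists k => //; have [_ _ _ E] := BN k.
  suff : (B k `\` N k) x by case.
  by rewrite -E; split => // Nk; apply: xN; exists k.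
- move: xA => [k _ Bk]; have [_ _ _ E] := BN k.
  have : (B k `\` N k) x by split => // Nk; apply: xN; exists k.
  by rewrite -E => -[[]].
Qed.
End lebesgueRn_theory.

(** * Borel versions of Lebesgue measurable functions *)

Section borel_version.
Context {R : realType} {n : nat}.
Implicit Types (A B : set 'rV[R]_n).
Local Notation mu := (@lebesgue_borel R n).
Local Notation m := (lebesgueRn R n).
Local Notation mB := (@measurable _ (RV R n)).
Local Notation mL := (@measurable _ (Rn R n)).
Local Open Scope ereal_scope.

Lemma borel_version (g : 'rV[R]_n -> R) :
  measurable_fun [set: Rn R n] (g : Rn R n -> R) ->
  exists h N, [/\ measurable_fun [set: RV R n] (h : RV R n -> R), mB N,
    mu N = 0 & forall x, ~ N x -> h x = g x].
Proof.
move=> mg.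
have [a a_dense] : exists a : nat -> R,
    forall x y, (x < y)%R -> exists k, (x < a k < y)%R.
  exists (fun k => ratr (odflt 0%R (unpickle k : option rat))) => x y.
  move=> /rat_in_itvoo[q]; rewrite in_itv/= => xqy.
  by exists (pickle q); rewrite pickleK.
have /choice[B /choice[N BN]] k : exists B N, [/\ mB B, mB N, mu N = 0 &
    (g @^-1` `]a k, +oo[) `\` N = B `\` N].
  by apply: borel_approx; rewrite -[X in measurable X]setTI; apply: mg.
have mN k : mB (N k) by have [] := BN k.
have mN' : mB (\bigcup_k N k) by exact: bigcupT_measurable.
(* Outside the null set, the preimage of each ray with endpoint [a k] is Borel;
   on it [h] is constant. *)
pose h x : R := if x \in \bigcup_k N k then 0%R else g x.
exists h, (\bigcup_k N k); split => //.
- apply: (measurability _ (RGenOInfty.measurableE R)) => _ [_ [x ->] <-].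
  rewrite setTI.
  (* Borel approximations exist only for the countably many levels [a k], so that their exceptional
     sets have a null union; density of [a] recovers an arbitrary level [x]. *)
  have -> : h @^-1` `]x, +oo[%classic =
     \bigcup_(k in [set k | (x < a k)%R]) (h @^-1` `]a k, +oo[%classic).
    apply/seteqP; split => y /=; rewrite in_itv/= andbT.
      by move=> /a_dense[k /andP[xk kh]]; exists k => //; rewrite /= in_itv/= kh.
    by move=> [k /= xk]; rewrite in_itv/= andbT => /(lt_trans xk).
  apply: bigcup_measurable => k _.
  have [mBk _ _ E] := BN k.
  have BkN : g @^-1` `]a k, +oo[ `\` \bigcup_k N k = B k `\` \bigcup_k N k.
    have sub : ~` (\bigcup_k N k) `<=` ~` N k.
      by move=> y nN Nk; apply: nN; exists k.
    by rewrite !setDE -(setIidr sub) !setIA -!setDE E.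
  have [a0|a0] := ltP (a k) 0%R.
  - have -> : h @^-1` `]a k, +oo[ = (B k `\` \bigcup_k N k) `|` \bigcup_k N k.
      rewrite -BkN; apply/seteqP; split => y /=; rewrite /h.
        by case: ifPn => [/set_mem|/negP]; [right|left; split => // /mem_set].
      move=> [[gy Ny]|Ny]; first by rewrite ifF//; apply/negP => /set_mem.
      by rewrite ifT ?mem_set// in_itv/= a0.
    by apply: measurableU => //; exact: measurableD.
  - have -> : h @^-1` `]a k, +oo[ = B k `\` \bigcup_k N k.
      rewrite -BkN; apply/seteqP; split => y /=; rewrite /h.
        case: ifPn => [/set_mem|/negP].
          by rewrite in_itv/= ltNge a0.
        by split => // /mem_set.
      by move=> [gy Ny]; rewrite ifF//; apply/negP => /set_mem.
    exact: measurableD.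
- have N0 k : mu (N k) = 0 by have [] := BN k.
  apply/eqP; rewrite eq_le measure_ge0 andbT.
  have -> : 0 = \sum_(0 <= k <oo) mu (N k) by rewrite eseries0.
  exact: measure_sigma_subadditive.
- by move=> x Nx; rewrite /h ifF//; apply/negP => /set_mem.
Qed.

Lemma borel_measurable_Rn d (T : measurableType d) (h : 'rV[R]_n -> T) :
  measurable_fun [set: RV R n] (h : RV R n -> T) ->
  measurable_fun [set: Rn R n] (h : Rn R n -> T).
Proof. by move=> mh _ Y mY; apply: measurable_RnW; exact: mh. Qed.

Lemma ae_measurable_Rn d (T : measurableType d) (g h : 'rV[R]_n -> T) N :
  measurable_fun [set: RV R n] (h : RV R n -> T) ->
  m N = 0 -> (forall x, ~ N x -> h x = g x) ->
  measurable_fun [set: Rn R n] (g : Rn R n -> T).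
Proof.
move=> mh N0 hg _ Y mY; rewrite setTI.
have sub0 A : A `<=` N -> mL A.
  move=> AN; apply: lebesgueRn_null; apply/eqP.
  by rewrite eq_le measure_ge0 andbT -N0 le_lebesgueRn.
have -> : g @^-1` Y = (h @^-1` Y `\` N) `|` (g @^-1` Y `&` N).
  apply/seteqP; split => x /=.
    by move=> gx; have [?|?] := pselect (N x); [right|left; rewrite hg].
  by move=> [[]|[]//] + Nx; rewrite hg.
apply: measurableU; last by apply: sub0; exact: subIsetr.
apply: measurableD; last exact: sub0.
by rewrite -[X in measurable X]setTI; exact: (borel_measurable_Rn mh).
Qed.

(** The identity from [Rn] to [RV] is measurable and pushes the completed measure forward to the
    Borel one. *)
Lemma integral_borel (h : 'rV[R]_n -> \bar R) :
  measurable_fun [set: RV R n] (h : RV R n -> \bar R) ->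
  \int[m]_x h x = \int[mu]_x h x.
Proof.
move=> mh.
have ge0 (k : RV R n -> \bar R) : measurable_fun setT k -> (forall x, 0 <= k x) ->
    \int[m]_x k x = \int[mu]_x k x.
  move=> mk k0.
  have mid : measurable_fun [set: Rn R n] (id : Rn R n -> RV R n).
    exact: borel_measurable_Rn.
  transitivity (\int[pushforward m (id : Rn R n -> RV R n)]_x k x).
    by rewrite ge0_integral_pushforward.
  apply: eq_measure_integral => A mA _; exact: lebesgueRnE.
rewrite integralE [RHS]integralE; congr (_ - _); apply: ge0 => //.
- exact: measurable_funepos.
- exact: measurable_funeneg.
Qed.

(** Completeness makes [g] Lebesgue measurable as soon as it agrees almost everywhere with a Borel
    [h]. This moves the integrals of [f] and of the fractional integral to the Borel side. *)
Lemma ae_integral_borel (g h : 'rV[R]_n -> \bar R) N :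
  measurable_fun [set: RV R n] (h : RV R n -> \bar R) ->
  m N = 0 -> (forall x, ~ N x -> h x = g x) ->
  \int[m]_x g x = \int[mu]_x h x.
Proof.
move=> mh N0 hg; rewrite -(integral_borel mh).
apply: ae_eq_integral; first exact: measurableT.
- exact: (ae_measurable_Rn mh N0).
- exact: borel_measurable_Rn.
exists N; split => //; first exact: lebesgueRn_null.
by move=> x /= /not_implyP[_]; apply: contra_notP => /hg.
Qed.
End borel_version.

(** * Continuity of translations in L^1 *)

Lemma ge0_cvge0P (R : realType) (u : nat -> \bar R) :
  (forall k, 0 <= u k)%E ->
  u @ \oo --> 0%E <->
  forall e : R, 0 < e -> \forall k \near \oo, (u k <= e%:E)%E.
Proof.
move=> u0; split.
  move=> /fine_cvgP[ufin /cvgr0Pnorm_le u0'] e e0.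
  near=> k; rewrite -[u k]fineK; last by near: k.
  rewrite lee_fin; apply: le_trans (ler_norm _) _; near: k; exact: u0'.
move=> ule; apply/fine_cvgP; split.
  near=> k; rewrite ge0_fin_numE//.
  suff : (u k <= 1%:E)%E by move=> /le_lt_trans; apply; rewrite ltry.
  by near: k; exact: ule.
apply/cvgr0Pnorm_le => e e0; near=> k.
have uke : (u k <= e%:E)%E by near: k; exact: ule.
rewrite /= ger0_norm ?fine_ge0// -lee_fin fineK//.
by rewrite ge0_fin_numE// (le_lt_trans uke)// ltry.
Unshelve. all: by end_near. Qed.

Section L1_continuity.
Context d (T : measurableType d) (R : realType).
Variables (mu : {measure set T -> \bar R}) (phi : nat -> T -> T).
Hypothesis mphi : forall k, measurable_fun setT (phi k).
Hypothesis mu_phi : forall k A, measurable A -> mu (phi k @^-1` A) = mu A.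
Local Open Scope ereal_scope.

Let dist (g : T -> R) k := \int[mu]_x `|(g (phi k x) - g x)%:E|.

Let good (g : T -> R) := measurable_fun setT g /\ dist g @ \oo --> 0.

Let dist_ge0 g k : 0 <= dist g k.
Proof. by apply: integral_ge0 => x _; exact: abse_ge0. Qed.

Let goodP g : measurable_fun setT g ->
  (forall e : R, (0 < e)%R -> \forall k \near \oo, dist g k <= e%:E) -> good g.
Proof. by move=> mg h; split => //; apply/ge0_cvge0P. Qed.

Let ge0_integral_phi k (h : T -> \bar R) : measurable_fun setT h ->
  (forall x, 0 <= h x) -> \int[mu]_x h (phi k x) = \int[mu]_x h x.
Proof.
move=> mh h0; transitivity (\int[pushforward mu (phi k)]_x h x).
  by rewrite ge0_integral_pushforward.
by apply: eq_measure_integral => A mA _; exact: mu_phi.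
Qed.

Let mdist (g : T -> R) k : measurable_fun setT g ->
  measurable_fun setT (fun x => `|(g (phi k x) - g x)%:E|).
Proof.
move=> mg; apply: measurableT_comp => //; apply/measurable_EFinP.
by apply: measurable_funB => //; exact: measurableT_comp.
Qed.

Let goodD g h : good g -> good h -> good (g \+ h)%R.
Proof.
move=> [mg g0] [mh h0]; split; first exact: measurable_funD.
apply: (@squeeze_cvge _ _ _ _ (cst 0) _ (fun k => dist g k + dist h k)).
- apply: nearW => k; rewrite dist_ge0/= /dist -ge0_integralD//; last 2 first.
  + exact: mdist.
  + exact: mdist.
  apply: ge0_le_integral => //.
  + by apply: mdist; exact: measurable_funD.
  + by apply: emeasurable_funD; exact: mdist.
  move=> x _ /=; rewrite -EFinD lee_fin.
  rewrite (_ : _ - _ = (g (phi k x) - g x) + (h (phi k x) - h x))%R ?ler_normD//.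
  by ring.
- exact: cvg_cst.
- by rewrite -[X in _ --> X]adde0; apply: cvgeD.
Qed.

Let goodZ c g : good g -> good (fun x => c * g x)%R.
Proof.
move=> [mg g0]; split; first exact: measurable_funM.
have -> : dist (fun x => c * g x)%R = fun k => `|c|%:E * dist g k.
  apply/funext => k; rewrite /dist -ge0_integralZl//; last exact: mdist.
  by apply: eq_integral => x _; rewrite -mulrBr EFinM abseM.
by rewrite -[X in _ --> X](mule0 `|c|%:E); apply: cvgeZl.
Qed.

Let good0 : good (cst 0%R).
Proof.
split => //; rewrite (_ : dist _ = cst 0); first exact: cvg_cst.
apply/funext => k; rewrite /dist (eq_integral (cst 0)) ?integral0//.
by move=> x _; rewrite subrr abse0.
Qed.

(** Three-term estimate: since [phi k] preserves [mu], composing [g] and [h] with it leaves their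
    L^1 distance unchanged, uniformly in [k]. *)
Let good_approx (g : T -> R) : measurable_fun setT g ->
  (forall e : R, (0 < e)%R ->
    exists2 h, good h & \int[mu]_x `|(g x - h x)%:E| <= e%:E) -> good g.
Proof.
move=> mg gh; apply: goodP => // e e0.
have e3 : (0 < e / 3)%R by rewrite divr_gt0.
have [h [mh h0] ghe] := gh _ e3.
have mgh : measurable_fun setT (fun x => `|(g x - h x)%:E|).
  by apply: measurableT_comp => //; apply/measurable_EFinP; exact: measurable_funB.
near=> k.
have hk : dist h k <= (e / 3)%:E.
  by near: k; move: h0 => /(ge0_cvge0P (dist_ge0 h))/(_ _ e3).
rewrite (_ : e = e / 3 + e / 3 + e / 3)%R; last by field.
have le1 : dist g k <= \int[mu]_x (`|(g (phi k x) - h (phi k x))%:E| +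
    `|(h (phi k x) - h x)%:E| + `|(g x - h x)%:E|).
  apply: ge0_le_integral => //.
  - exact: mdist.
  - apply: emeasurable_funD => //; apply: emeasurable_funD; last exact: mdist.
    exact: (measurableT_comp mgh).
  move=> x _ /=; rewrite -!EFinD lee_fin.
  rewrite (distrC (g x)) (_ : _ - _ = (g (phi k x) - h (phi k x)) +
    (h (phi k x) - h x) + (h x - g x))%R; last by ring.
  by rewrite (le_trans (ler_normD _ _))// lerD2r ler_normD.
apply: (le_trans le1); rewrite ge0_integralD//; last 2 first.
- by move=> x _; rewrite adde_ge0.
- by apply: emeasurable_funD; [exact: (measurableT_comp mgh)|exact: mdist].
rewrite ge0_integralD//; last 2 first.
- exact: (measurableT_comp mgh).
- exact: mdist.
rewrite (@ge0_integral_phi k (fun x => `|(g x - h x)%:E|))//.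
by rewrite !EFinD leeD// leeD.
Unshelve. all: by end_near. Qed.

Let good_limit (g_ : nat -> T -> R) g (h : T -> \bar R) : (forall i, good (g_ i)) ->
  mu.-integrable setT h -> (forall i x, `|(g_ i x)%:E| <= h x) ->
  (forall x, g_ ^~ x @ \oo --> g x) -> good g.
Proof.
move=> goodg ih g_h g_g.
have mg_ i : measurable_fun setT (g_ i) by have [] := goodg i.
have mg : measurable_fun setT g by apply: measurable_fun_cvg => // x _.
apply: good_approx => // e e0.
have [| | | | |_ + _] := @dominated_convergence _ _ _ mu setT measurableT
  (fun i x => (g_ i x)%:E) (EFin \o g) h.
- by move=> i; exact/measurable_EFinP.
- exact/measurable_EFinP.
- by apply: aeW => x _; apply: cvg_EFin; [exact: nearW|exact: g_g].
- exact: ih.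
- by apply: aeW => x i _; exact: g_h.
move=> /ge0_cvge0P /= gg.
have [|N _ /(_ N (leqnn N)) gN] := gg _ e e0.
  by move=> k; exact: integral_ge0.
exists (g_ N) => //.
by under eq_integral do rewrite distrC.
Qed.

(* The sets of [G] play the role of open sets: the only topological input is
   that [phi k x] eventually stays in any [U] of [G] that contains [x]. *)
Variables (G : set (set T)) (S : nat -> set T).
Hypothesis measurableG : @measurable _ T = <<s G >>.
Hypothesis G_setI : setI_closed G.
Hypothesis phi_G : forall U x, G U -> U x -> \forall k \near \oo, U (phi k x).
Hypothesis GS : forall j, G (S j).
Hypothesis muS : forall j, mu (S j) < +oo.
Hypothesis ndS : nondecreasing_seq S.
Hypothesis ST : \bigcup_j S j = setT.

Let mG U : G U -> measurable U.
Proof. by move=> GU; rewrite measurableG; exact: sub_gen_smallest. Qed.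

Let muE A : measurable A -> mu A = \int[mu]_x (\1_A x)%:E.
Proof. by move=> mA; rewrite integral_indic// setIT. Qed.

Let m1 A : measurable A -> measurable_fun setT (fun x : T => (\1_A x)%:E : \bar R).
Proof. by move=> mA; apply/measurable_EFinP. Qed.

Let integrable1 A : measurable A -> mu A < +oo ->
  mu.-integrable setT (fun x : T => (\1_A x)%:E : \bar R).
Proof.
move=> mA muA; apply/integrableP; split; first exact: m1.
by under eq_integral do rewrite gee0_abs ?lee_fin//; rewrite -muE.
Qed.

Let good_G U : G U -> mu U < +oo -> good \1_U.
Proof.
move=> GU muU; have mU := mG GU.
pose V k := U `\` phi k @^-1` U.
have mphiU k : measurable (phi k @^-1` U).
  by rewrite -[X in measurable X]setTI; exact: mphi.
have mV k : measurable (V k) by exact: measurableD.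
have muUfin : mu U \is a fin_num by rewrite ge0_fin_numE.
have distE k : dist \1_U k = 2%:E * mu (V k).
  (* Integrate [|a - b| + b = a + 2 (b - a)^+] with [a = \1_U \o phi k] and
     [b = \1_U], which have the same integral. *)
  suff : dist \1_U k + mu U = 2%:E * mu (V k) + mu U.
    by move=> /(congr1 (fun z => z - mu U)); rewrite !addeK.
  rewrite -[in RHS](mu_phi k mU) (muE mU) (muE (mV k)) (muE (mphiU k)).
  rewrite -ge0_integralZl//; last exact: m1.
  rewrite -!ge0_integralD//; try exact: m1; try exact: mdist.
  - apply: eq_integral => x _; rewrite /V !indicE /= -EFinM -!EFinD.
    congr EFin; rewrite in_setD.
    have -> : (x \in phi k @^-1` U) = (phi k x \in U).
      by apply/idP/idP => /set_mem ?; exact/mem_set.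
    by case: (x \in U); case: (phi k x \in U) => /=;
      rewrite ?subrr ?subr0 ?sub0r ?normrN ?normr0 ?normr1; lra.
  - by apply: measurable_funeM; exact: m1.
split; first exact: measurable_indic.
(* Each point is eventually outside [V k]: trivially if it is not in [U], and by [phi_G] if it is.
   The indicators are dominated by that of [U]. *)
have V0 : mu (V k) @[k --> \oo] --> 0.
  under eq_fun do rewrite muE//.
  have [| | | | |_ _] := @dominated_convergence _ _ _ mu setT measurableT
    (fun k x => (\1_(V k) x)%:E) (cst 0) (fun x => (\1_U x)%:E).
  - by move=> k; exact: m1.
  - exact: measurable_cst.
  - apply: aeW => x _; apply: cvg_near_cst; have [Ux|nUx] := pselect (U x).
      near=> k; rewrite indicE memNset// => -[_]; apply.
      by near: k; exact: phi_G.
    by near=> k; rewrite indicE memNset// => -[].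
  - exact: integrable1.
  - apply: aeW => x k _; rewrite gee0_abs ?lee_fin// !indicE ler_nat.
    by rewrite /V in_setD; case: (x \in U); case: (x \in _).
  by rewrite integral0.
rewrite (_ : dist _ = fun k => 2%:E * mu (V k)); last exact/funext.
by rewrite -[X in _ --> X](mule0 2%:E); apply: cvgeZl.
Unshelve. all: by end_near. Qed.

(** Dynkin induction from the pi-system [G]. Intersecting with [S j] keeps all measures finite,
    which complements would not; the indicator of a disjoint union is a dominated limit of finite
    sums. *)
Let good_indicS A j : measurable A -> good \1_(A `&` S j).
Proof.
move=> mA; move: j; rewrite measurableG in mA.
have muI B j : measurable B -> mu (B `&` S j) < +oo.
  move=> mB; apply: le_lt_trans (muS j); apply: le_measure; rewrite ?inE//.
    by apply: measurableI => //; exact: mG.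
    by exact: mG.
pose P B := forall j, good \1_(B `&` S j).
apply: (@dynkin_induction _ _ G P measurableG G_setI) mA => //.
- by move=> j; rewrite setTI; exact: good_G.
- by move=> U GU j; apply: good_G; [exact: G_setI|apply: muI; exact: mG].
- move=> B mB PB j.
  have -> : \1_(~` B `&` S j) =
      (\1_(S j) \+ (fun x => -1 * \1_(B `&` S j) x))%R :> (T -> R).
    apply/funext => x /=; rewrite !indicE !in_setI in_setC.
    by case: (x \in B); case: (x \in S j) => /=; lra.
  by apply: goodD; [exact: good_G|exact: goodZ].
- move=> F mF tF PF j.
  pose g_ i : T -> R := \1_((\big[setU/set0]_(l < i) F l) `&` S j).
  have mFi i : measurable (\big[setU/set0]_(l < i) F l) by exact: bigsetU_measurable.
  have mF' : measurable (\bigcup_k F k) by exact: bigcupT_measurable.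
  apply: (@good_limit g_ _ (fun x => (\1_((\bigcup_k F k) `&` S j) x)%:E)).
  + elim=> [|i IH].
      by rewrite /g_ big_ord0 set0I indic0; exact: good0.
    rewrite (_ : g_ i.+1 = g_ i \+ \1_(F i `&` S j))%R.
      by apply: goodD => //; exact: PF.
    apply/funext => x; rewrite /g_ /= big_ord_recr/= !indicE !in_setI in_setU.
    have [xi|xi] := boolP (x \in F i); last by rewrite orbF andFb addr0.
    rewrite (_ : (x \in \big[setU/set0]_(l < i) F l) = false) /= ?add0r//.
    apply/negP => /set_mem; rewrite -bigcup_mkord => -[l /= li Flx].
    move/trivIsetP : tF => /(_ l i I I); rewrite neq_ltn li => /(_ isT) E.
    suff : set0 x by []. 
    by rewrite -E; split => //; exact: set_mem.
  + by apply: integrable1; [apply: measurableI => //; exact: mG|exact: muI].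
  + move=> i x; rewrite gee0_abs ?lee_fin// /g_ !indicE ler_nat !in_setI.
    case: (x \in S j); rewrite ?andbF// !andbT.
    have [/set_mem|//] := boolP (x \in \big[setU/set0]_(l < i) F l).
    by rewrite -bigcup_mkord => -[l /= _ Fx]; rewrite mem_set//; exists l.
  + move=> x; apply: cvg_near_cst.
    have [[l _ Flx]|nx] := pselect ((\bigcup_k F k) x).
      near=> i; rewrite /g_ !indicE !in_setI.
      rewrite [x \in \bigcup_k _]mem_set; last by exists l.
      rewrite mem_set// -bigcup_mkord; exists l => //=.
      by near: i; exact: nbhs_infty_gt.
    near=> i; rewrite /g_ !indicE !in_setI [x \in \bigcup_k _]memNset//.
    by rewrite memNset// -bigcup_mkord => -[l /= _ Fx]; apply: nx; exists l.
Unshelve. all: by end_near. Qed.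

Import HBSimple HBNNSimple.

(** The level set of the value 0 may have infinite measure, so [s] is first cut off by the indicator
    of [S j]; then [j] tends to infinity under the dominating function [|s|]. *)
Let good_sfun (s : {sfun T >-> R}) : mu.-integrable setT (EFin \o s) -> good s.
Proof.
move=> intS.
have gS j : good (fun x => s x * \1_(S j) x)%R.
  have sE x : s x = (\sum_(y <- finmap.enum_fset (fset_set (range s)))
      y * \1_(s @^-1` [set y]) x)%R.
    by rewrite {1}(fimfunE s x) fsbig_finite.
  have -> : (fun x => s x * \1_(S j) x)%R =
     (fun x => \sum_(y <- finmap.enum_fset (fset_set (range s)))
        y * \1_(s @^-1` [set y] `&` S j) x)%R.
    apply/funext => x; rewrite sE mulr_suml; apply: eq_bigr => y _.
    by rewrite indicI /= mulrA.
  elim: (finmap.enum_fset _) => [|y l IH].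
    by under eq_fun do rewrite big_nil; exact: good0.
  under eq_fun do rewrite big_cons; apply: goodD => //.
  apply: goodZ; apply: good_indicS.
  by rewrite -[X in measurable X]setTI; exact: (measurable_funPT s).
apply: (good_limit gS (integrable_abse intS)) => [j x|x].
  rewrite /= lee_fin normrM indicE.
  by case: (x \in S j); rewrite ?normr1 ?mulr1 ?normr0 ?mulr0.
apply: cvg_near_cst.
have : (\bigcup_j S j) x by rewrite ST.
move=> [N _ SNx]; near=> j; rewrite indicE mem_set ?mulr1//.
have : (S N <= S j)%O by apply: ndS; near: j; exact: nbhs_infty_ge.
by move=> /subsetPset; apply.
Unshelve. all: by end_near. Qed.

Lemma integral_comp_dist_cvg0 (g : T -> R) : mu.-integrable setT (EFin \o g) ->
  (\int[mu]_x `|(g (phi k x) - g x)%:E|) @[k --> \oo] --> 0.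
Proof.
move=> ig; have mg : measurable_fun setT g.
  by apply/measurable_EFinP; exact: measurable_int ig.
suff [] : good g by [].
apply: good_approx => // e e0.
have [g_ [ig_ _ gg_]] := approximation_sfun_integrable measurableT ig.
move: gg_ => /ge0_cvge0P /= gg.
have [|N _ /(_ N (leqnn N)) gN] := gg _ e e0.
  by move=> k; exact: integral_ge0.
by exists (g_ N) => //; exact: good_sfun.
Qed.
End L1_continuity.

Section translation.
Context {R : realType}.

Definition cube n (r : R) : set 'rV[R]_n := [set x | forall i, `|x ord0 i| < r].
Local Arguments cube : clear implicits.

Let cubeE n r : cube n r =
  \bigcap_(i in [set: 'I_n]) (fun x : 'rV[R]_n => x ord0 i) @^-1` `]-r, r[%classic.
Proof.
apply/seteqP; split => x /= h i => [_|]; first by rewrite /= in_itv/= -ltr_norml.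
by have := h i I; rewrite /= in_itv/= -ltr_norml.
Qed.

Let measurable_cube n r : measurable (cube n r : set (RV R n)).
Proof.
rewrite cubeE; apply: fin_bigcap_measurable => // i _.
by rewrite -[X in measurable X]setTI; apply: measurable_coord => //; exact: measurable_itv.
Qed.

Let cube_fin n r : (lebesgue_borel n (cube n r) < +oo)%E.
Proof.
elim: n => [|n IH]; first by rewrite /= diracE ltry.
rewrite /= /lebesgue_step /pushforward.
have -> : @rV_cons R n @^-1` cube n.+1 r = `]-r, r[%classic `*` cube n r.
  apply/predeqP => -[x v] /=.
  case: (rV_consK (x, v)) => xE /rowP vE.
  split => [h|[]].
    split=> [|i]; first by rewrite in_itv/= -ltr_norml -[X in `|X|]xE; exact: h.
    by have := vE i; rewrite mxE => <-; exact: h.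
  rewrite in_itv/= -ltr_norml -[X in `|X|]xE => xr vr i.
  have [j ->|->//] := unliftP ord0 i.
  by have := vE j; rewrite mxE => ->; exact: vr.
rewrite product_measure1E//=; last exact: measurable_cube.
by rewrite lte_mul_pinfty// lebesgue_measure_itv/=; case: ifP => _; rewrite ?ltry.
Qed.

Lemma integral_translation_cvg0 n (g : 'rV[R]_n -> R) (v : nat -> 'rV[R]_n) :
  (lebesgue_borel n).-integrable setT (EFin \o g) ->
  (forall i, v k ord0 i @[k --> \oo] --> 0) ->
  (\int[lebesgue_borel n]_x `|(g (x - v k) - g x)%:E|)%E @[k --> \oo] --> 0%E.
Proof.
move=> ig v0.
pose phi k : RV R n -> RV R n := affine 1 (- v k).
have phiE k x : phi k x = x - v k by rewrite /phi /affine scale1r.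
(* The sets of [G] need not be open. Coordinatewise convergence of [x - v k] to [x] puts the
   coordinate preimages of open sets of reals into [G], and these generate the Borel sets. *)
pose G : set (set (RV R n)) := [set U | measurable U /\
  forall x, U x -> \forall k \near \oo, U (phi k x)].
have GI : setI_closed G.
  move=> A B [mA hA] [mB hB]; split; first exact: measurableI.
  by move=> x [Ax Bx]; apply: filterI; [exact: hA|exact: hB].
have Gopen i (O : set R) : open O -> G ((fun x : 'rV[R]_n => x ord0 i) @^-1` O).
  move=> oO; split.
    rewrite -[X in measurable X]setTI; apply: measurable_coord => //.
    exact: open_measurable.
  move=> x Ox; have : x ord0 i - v k ord0 i @[k --> \oo] --> x ord0 i.
    by rewrite -[X in _ --> X]subr0; apply: cvgB; [exact: cvg_cst|exact: v0].
  move=> /(_ O) /= /(_ (open_nbhs_nbhs (conj oO Ox))) [N _ NO].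
  by exists N => // k /NO; rewrite /= phiE !mxE.
have mG : @measurable _ (RV R n) = <<s G >>.
  apply/seteqP; split; last first.
    by apply: smallest_sub; [exact: sigma_algebra_measurable|move=> A []].
  move=> A mA.
  pose T' := g_sigma_algebraType G.
  have : measurable_fun [set: T'] (id : T' -> RV R n).
    apply: measurable_fun_rV => i.
    apply: (measurability _ (RGenOInfty.measurableE R)) => _ [_ [x ->] <-].
    by rewrite setTI; apply: sub_gen_smallest; apply: Gopen; exact: interval_open.
  by move=> /(_ measurableT A mA); rewrite setTI.
have -> : (fun k => \int[lebesgue_borel n]_x `|(g (x - v k) - g x)%:E|)%E =
  (fun k => \int[lebesgue_borel n]_x `|(g (phi k x) - g x)%:E|)%E.
  by apply/funext => k; apply: eq_integral => x _; rewrite phiE.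
apply: (@integral_comp_dist_cvg0 _ _ _ _ phi _ _ G (fun j => cube n j%:R)) => //.
- by move=> k; exact: measurable_affine.
- move=> k A mA; have /= := lebesgue_borel_affine (- v k) (oner_neq0 R) mA.
  by rewrite normr1 expr1n mul1e.
- by move=> U x [_]; apply.
- move=> j; split=> [|x xj]; first exact: measurable_cube.
  apply: filter_forall => i.
  have [_ /(_ x)] := Gopen i _
    (@interval_open _ (BRight (- j%:R : R)) (BLeft j%:R) isT isT).
  rewrite /= in_itv/= -ltr_norml => /(_ (xj i)).
  by apply: filterS => k; rewrite in_itv/= -ltr_norml.
- by move=> j; exact: cube_fin.
- move=> j l jl; apply/subsetPset => x xj i; apply: lt_le_trans (xj i) _.
  by rewrite ler_nat.
- apply/seteqP; split => // x _.
  exists (Num.bound (\sum_i `|x ord0 i|)) => // i.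
  apply: le_lt_trans (archi_boundP _); last by apply: sumr_ge0.
  by rewrite (bigD1 i)//= lerDl sumr_ge0.
Qed.
End translation.

(** * Convolution with a shrinking integrable function *)

Section convolution.
Context {R : realType} {n : nat}.
Variables (K f : 'rV[R]_n -> R) (s : nat -> R).
Local Notation mu := (@lebesgue_borel R n).
Local Open Scope ereal_scope.
Hypothesis iK : mu.-integrable setT (EFin \o K).
Hypothesis iF : mu.-integrable setT (EFin \o f).
Hypothesis s0 : s k @[k --> \oo] --> 0%R.

(** With the absolute value inside, this dominates the distance between [\int K (x - s y) f y dy]
    and [K x] times [\int f], and Tonelli applies to it directly. It is used with the truncated
    kernel in place of [K]. *)
Definition convolution_error k x :=
  \int[mu]_y `|((K (x - s k *: y) - K x) * f y)%:E|.
Local Notation H := convolution_error.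

Let mK : measurable_fun [set: RV R n] K.
Proof. by apply/measurable_EFinP; exact: measurable_int iK. Qed.

Let mF : measurable_fun [set: RV R n] f.
Proof. by apply/measurable_EFinP; exact: measurable_int iF. Qed.

Let F k (z : RV R n * RV R n) : \bar R :=
  `|((K (z.1 - s k *: z.2) - K z.1) * f z.2)%:E|.

Let mFk k : measurable_fun setT (F k).
Proof.
apply: measurableT_comp => //; apply/measurable_EFinP.
apply: measurable_funM; last exact: (measurableT_comp mF measurable_snd).
apply: measurable_funB; last exact: (measurableT_comp mK measurable_fst).
apply: (measurableT_comp mK).
apply: measurable_fun_rV => i; under eq_fun do rewrite !mxE.
apply: measurable_funB.
  exact: (measurableT_comp (measurable_coord i) measurable_fst).
apply: measurable_funM => //.
exact: (measurableT_comp (measurable_coord i) measurable_snd).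
Qed.

Lemma measurable_convolution_error k :
  measurable_fun [set: RV R n] (H k : RV R n -> _).
Proof.
by apply: (measurable_fun_fubini_tonelli_F (m2 := mu) (F k)) => // z;
  exact: abse_ge0.
Qed.

Let mKB v : measurable_fun [set: RV R n] (fun x : RV R n => K (x - v)).
Proof.
rewrite (_ : (fun x => _) = K \o affine 1 (- v)); last first.
  by apply/funext => x; rewrite /= /affine scale1r.
exact: (measurableT_comp mK (measurable_affine 1 (- v))).
Qed.

Let D k (y : 'rV[R]_n) := \int[mu]_x `|(K (x - s k *: y) - K x)%:E|.

Let D_le k y : D k y <= 2%:E * \int[mu]_x `|(K x)%:E|.
Proof.
have mKy := mKB (s k *: y).
apply: (@le_trans _ _ (\int[mu]_x (`|(K (x - s k *: y))%:E| + `|(K x)%:E|))).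
  apply: ge0_le_integral => //.
  - apply: measurableT_comp => //; apply/measurable_EFinP.
    exact: measurable_funB.
  - by apply: emeasurable_funD; apply: measurableT_comp => //; exact/measurable_EFinP.
  - by move=> x _ /=; rewrite lee_fin ler_normB.
rewrite ge0_integralD//; last 2 first.
- by apply: measurableT_comp => //; exact/measurable_EFinP.
- by apply: measurableT_comp => //; exact/measurable_EFinP.
rewrite (_ : 2%:E = 1 + 1)// ge0_muleDl// !mul1e leeD2r//.
pose phi : RV R n -> RV R n := affine 1 (- (s k *: y)).
suff -> : \int[mu]_x `|(K (x - s k *: y))%:E| = \int[mu]_x `|(K x)%:E| by [].
transitivity (\int[pushforward mu phi]_x `|(K x)%:E|).
  rewrite ge0_integral_pushforward//.
  - by apply: eq_integral => x _; rewrite /= /phi /affine scale1r.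
  - exact: measurable_affine.
  - by apply: measurableT_comp => //; apply/measurable_EFinP.
have mphi : measurable_fun setT phi by exact: measurable_affine.
apply: (eq_measure_integral mu
  (m1 := measure_function_pushforward__canonical__measure_function_Measure
    mu mphi)) => A mA _.
have /= := lebesgue_borel_affine (- (s k *: y))%R (oner_neq0 R) mA.
by rewrite normr1 expr1n mul1e.
Qed.

(** Tonelli turns the integral into that of [|f y| D k y]. For fixed [y], [D k y] tends to 0 by
    continuity of translations, and it is at most [2 ||K||_1], so dominated convergence applies. *)
Lemma integral_convolution_error_cvg0 : \int[mu]_x H k x @[k --> \oo] --> 0.
Proof.
have HE k : \int[mu]_x H k x = \int[mu]_y (`|(f y)%:E| * D k y).
  rewrite /H (fubini_tonelli (F k))//; last by move=> z; exact: abse_ge0.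
  apply: eq_integral => y _; rewrite /F /D -ge0_integralZl//.
    by apply: eq_integral => x _ /=; rewrite normrM mulrC.
  apply: measurableT_comp => //; apply/measurable_EFinP.
  exact: measurable_funB.
under eq_fun do rewrite HE.
have CK : 2%:E * \int[mu]_x `|(K x)%:E| < +oo.
  by rewrite lte_mul_pinfty//; have /integrableP[] := iK.
have [| | | | |_ _] := @dominated_convergence _ _ _ mu setT measurableT
  (fun k y => `|(f y)%:E| * D k y) (cst 0)
  (fun y => `|(f y)%:E| * (2%:E * \int[mu]_x `|(K x)%:E|)).
- move=> k.
  have -> : (fun y => `|(f y)%:E| * D k y) = fun y => \int[mu]_x F k (x, y).
    apply/funext => y; rewrite /F /D -ge0_integralZl//.
      by apply: eq_integral => x _ /=; rewrite normrM mulrC.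
    apply: measurableT_comp => //; apply/measurable_EFinP.
    exact: measurable_funB.
  by apply: (measurable_fun_fubini_tonelli_G (m1 := mu) (F k)) => // z;
    exact: abse_ge0.
- exact: measurable_cst.
- apply: aeW => y _; rewrite -[X in _ --> X](mule0 `|(f y)%:E|).
  apply: cvgeZl => //.
  apply: (integral_translation_cvg0 iK) => i.
  rewrite (_ : (fun k => _) = fun k => (s k * y ord0 i)%R); last first.
    by apply/funext => k; rewrite mxE.
  by rewrite -(mul0r (y ord0 i)); apply: cvgM => //; exact: cvg_cst.
- have CKfin : 2%:E * \int[mu]_x `|(K x)%:E| \is a fin_num.
    by rewrite ge0_fin_numE// mule_ge0// integral_ge0.
  rewrite -(fineK CKfin); apply: integrableZr => //; exact: integrable_abse.
- apply: aeW => y k _; rewrite gee0_abs ?mule_ge0 ?integral_ge0//.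
  by apply: lee_wpmul2l => //; exact: D_le.
by rewrite integral0.
Qed.

Lemma convolution_error_cvg0 (e : R) : (0 < e)%R ->
  mu [set x | e%:E <= H k x] @[k --> \oo] --> 0.
Proof.
move=> e0.
have H0 k x : 0 <= H k x by exact: integral_ge0.
apply: (@squeeze_cvge _ _ _ _ (cst 0) _ (fun k => e^-1%:E * \int[mu]_x H k x)).
- apply: nearW => k; rewrite measure_ge0/= -(@lee_pmul2l _ e%:E)// muleA -EFinM.
  rewrite divff ?gt_eqF// mul1e.
  (* Chebyshev's inequality. *)
  have := le_integral_abse mu measurableT (measurable_convolution_error k) e0.
  rewrite setTI; under eq_set do rewrite gee0_abs//.
  by under eq_integral do rewrite gee0_abs//.
- exact: cvg_cst.
- rewrite -[X in _ --> X](mule0 e^-1%:E); apply: cvgeZl => //.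
  exact: integral_convolution_error_cvg0.
Qed.

End convolution.

(** * Polar coordinates *)

Section enorm_theory.
Context {R : realType} {n : nat}.
Implicit Types (x : 'rV[R]_n).

Lemma enorm_ge0 x : 0 <= enorm x. Proof. exact: sqrtr_ge0. Qed.

Lemma enormZ (a : R) x : enorm (a *: x) = `|a| * enorm x.
Proof.
rewrite /enorm -(sqrtr_sqr a) -sqrtrM ?sqr_ge0//; congr Num.sqrt.
by rewrite mulr_sumr; apply: eq_bigr => i _; rewrite mxE exprMn.
Qed.

Lemma enorm0 : enorm (0 : 'rV[R]_n) = 0.
Proof. by rewrite -(scale0r 0) enormZ normr0 mul0r. Qed.

Lemma enorm_eq0 x : (enorm x == 0) = (x == 0).
Proof.
apply/idP/eqP => [|->]; last by rewrite enorm0.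
rewrite sqrtr_eq0 => sum_le0; apply/rowP => i; rewrite mxE.
apply/eqP; rewrite -sqrf_eq0 eq_le sqr_ge0 andbT; apply: le_trans sum_le0.
by rewrite (bigD1 i)//= lerDl sumr_ge0// => j _; exact: sqr_ge0.
Qed.

Lemma enorm_gt0 x : (0 < enorm x) = (x != 0).
Proof. by rewrite lt0r enorm_eq0 enorm_ge0 andbT. Qed.

Lemma measurable_enorm : measurable_fun [set: RV R n] (@enorm R n : RV R n -> R).
Proof.
rewrite /enorm; apply: (measurableT_comp (f := @Num.sqrt R)).
  by apply: continuous_measurable_fun; exact: sqrt_continuous.
apply: measurable_sum => i; apply: (measurable_funX 2).
exact: measurable_coord.
Qed.

End enorm_theory.

Section polar.
Context {R : realType} {n : nat}.
Hypothesis n_gt0 : (0 < n)%N.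
Local Notation m := (lebesgueRn R n).
Local Notation sigma := (surface_measure R n).
Local Open Scope ereal_scope.

(** The region under a radial graph, written with [|x|^n] instead of [|x|] because volume along a
    cone is linear in the n-th power of the radius: the volume is then linear in [g]. *)
Definition hypograph (g : 'rV[R]_n -> R) : set 'rV[R]_n :=
  [set x | (0 < enorm x)%R /\ (enorm x ^+ n < g ((enorm x)^-1 *: x))%R].

Let cone (c : R) (E : set 'rV[R]_n) : set 'rV[R]_n :=
  [set x | [/\ (0 < enorm x)%R, (enorm x ^+ n < c)%R & E ((enorm x)^-1 *: x)]].

Let cone_scale (c : R) E : (0 < c)%R ->
  exists2 t : R, (0 < t)%R &
    (t ^+ n = c)%R /\ cone c E = affine t^-1 0 @^-1` sector E.
Proof.
move=> c0; exists (c `^ n%:R^-1)%R; first exact: powR_gt0.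
set t := (c `^ _)%R.
have t0 : (0 < t)%R by exact: powR_gt0.
have tn : (t ^+ n = c)%R.
  by rewrite -powR_mulrn ?ltW// -powRrM mulVf ?powRr1 ?ltW// pnatr_eq0 -lt0n.
split => //; apply/seteqP; split => x; rewrite /cone /sector /= /affine addr0.
all: rewrite enormZ ger0_norm ?invr_ge0 ?ltW// invfM invrK scalerA.
all: rewrite mulrAC divff ?gt_eqF// mul1r.
  move=> [x0 xc Ex]; split => //; rewrite mulr_gt0 ?invr_gt0//=.
  rewrite mulrC ltr_pdivrMr// mul1r.
  by rewrite -(ltr_pXn2r n_gt0) ?nnegrE ?enorm_ge0 ?ltW// tn.
move=> [/andP[x0 x1] Ex].
have x0' : (0 < enorm x)%R by rewrite pmulr_rgt0 ?invr_gt0 in x0.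
split => //; rewrite -tn (ltr_pXn2r n_gt0) ?nnegrE ?enorm_ge0 ?ltW//.
by rewrite mulrC ltr_pdivrMr// mul1r in x1.
Qed.

Let measurable_cone c (E : set (Sn R n)) : measurable E ->
  measurable (cone c E : set (Rn R n)).
Proof.
move=> mE; have [c0|c0] := ltP 0%R c.
  have [t t0 [_ ->]] := cone_scale E c0.
  rewrite -[X in measurable X]setTI; apply: measurable_Rn_affine => //.
  by rewrite gt_eqF// invr_gt0.
rewrite (_ : cone c E = set0)//; apply/seteqP; split => // x [x0 xc _].
by have := lt_le_trans xc c0; rewrite ltNge exprn_ge0 ?enorm_ge0.
Qed.

Let lebesgueRn_cone c (E : set (Sn R n)) : (0 <= c)%R ->
  m (cone c E) = c%:E * m (sector E).
Proof.
rewrite le_eqVlt => /predU1P[<-|c0].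
  rewrite mul0e (_ : cone 0%R E = set0) ?measure0//.
  apply/seteqP; split => // x [x0 xc _].
  by move: xc; rewrite ltNge exprn_ge0 ?enorm_ge0.
have [t t0 [tc ->]] := cone_scale E c0.
rewrite -[in RHS](lebesgueRn_affine 0%R (sector E) (_ : t^-1 != 0)%R); last first.
  by rewrite gt_eqF// invr_gt0.
by rewrite muleA -EFinM ger0_norm ?invr_ge0 ?ltW// -tc -exprMn divff ?gt_eqF// expr1n mul1e.
Qed.

Import HBSimple HBNNSimple.

(** Over the level set of a value [y] the hypograph is a cone, namely a sector dilated by [y^(1/n)],
    so its volume is [y] times that of the sector. The cones of distinct values are disjoint, and
    the value 0 gives the empty cone. *)
Let lebesgueRn_hypograph_nnsfun (h : {nnsfun Sn R n >-> R}) :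
  measurable (hypograph h : set (Rn R n)) /\
  n%:R%:E * m (hypograph h) = \int[sigma]_x (h x)%:E.
Proof.
have E : hypograph h = \bigcup_(y in range h) cone y (h @^-1` [set y]).
  apply/seteqP; split => x.
    by move=> [x0 xh]; exists (h ((enorm x)^-1 *: x)).
  by move=> [y _ [x0 xy /= hxy]]; split => //; rewrite hxy.
have mh y : measurable (h @^-1` [set y] : set (Sn R n)).
  by rewrite -[X in measurable X]setTI; exact: (measurable_funPT h).
split.
  by rewrite E; apply: fin_bigcup_measurable => // y _; exact: measurable_cone.
rewrite integralT_nnsfun sintegralE E measure_fin_bigcup//; last 2 first.
- move=> y z _ _ [x [[_ _ /= <-] [_ _ /= <-]]] //.
- by move=> y _; exact: measurable_cone.
rewrite ge0_mule_fsumr//.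
apply: eq_fsbigr => y /set_mem[u _ <-].
transitivity (n%:R%:E * ((h u)%:E * m (sector (h @^-1` [set h u])))).
  by congr (_ * _); exact: lebesgueRn_cone.
by rewrite muleCA.
Qed.

(** Since the inequality in [hypograph] is strict, a point under [g] lies under some simple function
    of an increasing sequence with limit [g]. Thus the hypographs increase to that of [g], and
    monotone convergence gives the integral. *)
Lemma lebesgueRn_hypograph (g : Sn R n -> R) : measurable_fun setT g ->
  (forall x, 0 <= g x)%R ->
  measurable (hypograph g : set (Rn R n)) /\
  m (hypograph g) = n%:R^-1%:E * \int[sigma]_x (g x)%:E.
Proof.
move=> mg g0; have mg' : measurable_fun setT (EFin \o g) by exact/measurable_EFinP.
pose h k := nnsfun_approx measurableT mg' k.
have hg : (forall x, (fun k => (h k x)%:E) @ \oo --> (g x)%:E).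
  by move=> x; apply: cvg_nnsfun_approx => // y _; rewrite lee_fin.
have ndh x : {homo h ^~ x : k l / (k <= l)%N >-> (k <= l)%R}.
  by move=> k l kl; exact/lefP/nd_nnsfun_approx.
have hle k x : (h k x <= g x)%R.
  rewrite -lee_fin; apply: (cvge_ge _ (hg x)).
  by exists k => // l /= kl; rewrite lee_fin; exact: ndh.
have E : hypograph g = \bigcup_k hypograph (h k).
  apply/seteqP; split => x.
    move=> [x0 xg].
    apply: contrapT => nx; move: xg; apply/negP; rewrite -leNgt -lee_fin.
    apply: (cvge_le _ (hg _)); apply: nearW => k; rewrite lee_fin leNgt.
    by apply/negP => xk; apply: nx; exists k.
  by move=> [k _ [x0 xh]]; split => //; exact: (lt_le_trans xh).
have mH k := (lebesgueRn_hypograph_nnsfun (h k)).1.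
have mHg : measurable (hypograph g : set (Rn R n)).
  by rewrite E; exact: bigcupT_measurable.
split => //.
have c1 : m (hypograph (h k)) @[k --> \oo] --> m (hypograph g).
  rewrite E; apply: nondecreasing_cvg_mu => //; first by rewrite -E.
  move=> k l kl; apply/subsetPset => x [x0 xh]; split => //.
  by apply: lt_le_trans xh _; exact: ndh.
have c2 : n%:R^-1%:E * \int[sigma]_x (h k x)%:E @[k --> \oo] -->
   n%:R^-1%:E * \int[sigma]_x (g x)%:E.
  apply: cvgeZl => //; rewrite (_ : \int[sigma]_x (g x)%:E =
      \int[sigma]_x limn (fun k => (h k x)%:E)).
    apply: cvg_monotone_convergence; first exact: measurableT.
    - by move=> k; exact/measurable_EFinP/measurable_funP.
    - by move=> k x _; rewrite lee_fin.
    - by move=> x _ k l kl; rewrite lee_fin; exact: ndh.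
  by apply: eq_integral => x _; apply/esym/cvg_lim => //; exact: hg.
apply: (cvg_unique _ c1) => //.
rewrite (_ : (fun k => m (hypograph (h k))) =
  (fun k => n%:R^-1%:E * \int[sigma]_x (h k x)%:E)); first exact: c2.
apply/funext => k; rewrite -(lebesgueRn_hypograph_nnsfun (h k)).2 muleA -EFinM.
by rewrite mulVf ?mul1e// pnatr_eq0 -lt0n.
Qed.
End polar.

(** * The homogeneous kernel *)

(** The large values are kept and the small ones replaced by 0, so that what is removed is bounded
    by [e]. *)
Definition truncate (R : realType) (T : Type) (e : R) (h : T -> R) (x : T) : R :=
  if e < `|h x| then h x else 0.

Lemma powR_exprn (R : realType) (x r : R) k : 0 <= x -> (x ^+ k) `^ r = (x `^ r) ^+ k.
Proof.
move=> x0; elim: k => [|k IH]; first by rewrite !expr0 powR1.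
by rewrite !exprS powRM ?exprn_ge0// IH.
Qed.

Lemma ltr_powRn2r (R : realType) (x y r : R) : 0 < r -> 0 <= x -> 0 <= y ->
  (x `^ r < y `^ r) = (x < y).
Proof.
move=> r0 x0 y0; apply/idP/idP; last by apply: gt0_ltr_powR; rewrite // nnegrE.
by apply: contraTT; rewrite -!leNgt; apply: ge0_ler_powR; rewrite ?nnegrE// ltW.
Qed.

(** * Integrability of the large part of a weak L^r function *)

Section weak_type.
Context d (T : measurableType d) (R : realType).
Variables (mu : {measure set T -> \bar R}) (h : T -> R) (A r e : R).
Hypothesis mh : measurable_fun setT h.
Hypothesis r_gt1 : 1 < r.
Hypothesis e_gt0 : 0 < e.
Hypothesis weak_h : forall u : R, 0 < u ->
  (mu [set x | (u < `|h x|)%R] <= (A / u `^ r)%:E)%E.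
Local Open Scope ereal_scope.

Let lvl k := [set x | (2 ^+ k * e < `|h x|)%R].

Let mlvl k : measurable (lvl k).
Proof.
rewrite -[X in measurable X]setTI.
have mnh : measurable_fun setT (fun x => `|h x|%R) by exact: measurableT_comp.
rewrite (_ : setT `&` _ =
  setT `&` (fun x => `|h x|%R) @^-1` `](2 ^+ k * e)%R, +oo[%classic).
  by apply: mnh => //; exact: measurable_itv.
by apply/seteqP; split => x [_] /=; rewrite in_itv/= andbT.
Qed.

Lemma measurable_truncate : measurable_fun setT (truncate e h).
Proof.
have -> : truncate e h = h \_ (lvl 0).
  apply/funext => x; rewrite /truncate patchE /lvl expr0 mul1r.
  by case: ifPn => hx; [rewrite mem_set|rewrite memNset// => /=; exact/negP].
by apply/measurable_restrict => //; exact: measurable_funTS.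
Qed.

Lemma integrable_truncate : mu.-integrable setT (EFin \o truncate e h).
Proof.
apply/integrableP; split; first exact/measurable_EFinP/measurable_truncate.
have two_gt0 k : (0 < 2 ^+ k :> R)%R by exact: exprn_gt0.
(* Dyadic layers: the term of index [k] bounds [|h|] where
   [2^k e < |h| <= 2^(k+1) e]. *)
pose F k x : \bar R := (2 ^+ k.+1 * e)%:E * (\1_(lvl k) x)%:E.
have F0 k x : 0 <= F k x by rewrite mule_ge0// lee_fin ltW// mulr_gt0.
have mF k : measurable_fun setT (F k).
  by apply: measurable_funeM; apply/measurable_EFinP.
have le_hF x : `|(truncate e h x)%:E| <= \sum_(k <oo) F k x.
  rewrite /truncate; case: ifPn => [ehx|_]; last first.
    by rewrite abse0; apply: nneseries_ge0.
  have : exists N, (`|h x| <= 2 ^+ N * e)%R.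
    exists (Num.bound (`|h x| / e)); rewrite -ler_pdivrMr//.
    apply: le_trans (ltW (archi_boundP _)) _; first by rewrite divr_ge0// ltW.
    by rewrite -natrX ler_nat ltnW// ltn_expl.
  move=> /ex_minnP[[|k]]; first by rewrite expr0 mul1r leNgt ehx.
  move=> hk kmin; have hk' : lvl k x.
    by rewrite /lvl /= ltNge; apply/negP => /kmin; rewrite ltnn.
  rewrite (nneseriesD1 (n := k))//.
  apply: lee_paddr; first exact: nneseries_ge0.
  by rewrite /F indicE mem_set// mule1 lee_fin.
apply: (@le_lt_trans _ _ (\int[mu]_x \sum_(k <oo) F k x)).
  apply: ge0_le_integral => //.
  - by apply: measurableT_comp => //; exact/measurable_EFinP/measurable_truncate.
  - by apply: ge0_emeasurable_sum.
  - by move=> x _; exact: le_hF.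
rewrite integral_nneseries//.
(* On layer [k] the height [2^(k+1) e] meets the weak bound [A / (2^k e)^r], giving a geometric
   series of ratio [q = 2^(1 - r)], which is less than 1 because [r > 1]. *)
pose q : R := (2 / 2 `^ r)%R; pose a : R := (2 * e * (A / e `^ r))%R.
have le_F k : \int[mu]_x F k x <= (a * q ^+ k)%:E.
  rewrite /F ge0_integralZl//; last 2 first.
  - exact/measurable_EFinP.
  - by rewrite lee_fin ltW// mulr_gt0.
  rewrite integral_indic// setIT.
  have u0 : (0 < 2 ^+ k * e)%R by rewrite mulr_gt0.
  apply: (@le_trans _ _ ((2 ^+ k.+1 * e)%:E * (A / (2 ^+ k * e) `^ r)%:E)).
    by apply: lee_wpmul2l (weak_h u0); rewrite lee_fin ltW// mulr_gt0.
  rewrite -EFinM lee_fin le_eqVlt; apply/orP; left; apply/eqP.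
  have -> : (((2 ^+ k * e) `^ r) = (2 `^ r) ^+ k * e `^ r)%R.
    rewrite powRM ?ltW//; congr (_ * _)%R.
    by rewrite powR_exprn.
  rewrite /a /q exprMn exprS exprVn.
  have := powR_gt0 r e_gt0; have := @powR_gt0 R 2 r (ltr0n R 2).
  move=> /(exprn_gt0 k) p1 p2; field.
  by rewrite !gt_eqF.
apply: (@le_lt_trans _ _ (\sum_(k <oo) (a * q ^+ k)%:E)).
  by apply: lee_nneseries => [k _ _|k _]; [apply: integral_ge0|exact: le_F].
have q1 : (`|q| < 1)%R.
  rewrite ger0_norm ?divr_ge0 ?powR_ge0// ltr_pdivrMr ?powR_gt0// mul1r.
  rewrite -[ltLHS](powRr1 (ltW (ltr0n R 2))).
  by rewrite /powR gt_eqF// ltr_expR ltr_pM2r// ln_gt0 ?ltr1n.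
have -> : \sum_(k <oo) (a * q ^+ k)%:E = (a * (1 - q)^-1)%:E.
  apply/cvg_lim => //.
  rewrite (_ : (fun k => _) = EFin \o series (geometric a q)); last first.
    by apply/funext => k; rewrite /= /series /= sumEFin.
  by apply: cvg_EFin; [exact: nearW|exact: cvg_geometric_series].
by rewrite ltry.
Qed.
End weak_type.

Section kernel.
Context {R : realType} {n : nat}.
Variables (alpha r : R) (Omega : 'rV[R]_n -> R).
Hypothesis alphaP : 0 < alpha < n%:R.
Hypothesis rE : r = n%:R / (n%:R - alpha).
Hypothesis mOmega :
  measurable_fun ([set x | x != 0] : set (Rn R n)) (Omega : Rn R n -> R).
Hypothesis homO : forall (t : R) (x : 'rV[R]_n), 0 < t -> x != 0 ->
  Omega (t *: x) = Omega x.
Hypothesis LOmega : (Omega : Sn R n -> R) \in Lfun (surface_measure R n) r%:E.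
Local Notation m := (lebesgueRn R n).
Local Notation sigma := (surface_measure R n).

Definition kernel (x : 'rV[R]_n) : R := Omega x / enorm x `^ (n%:R - alpha).

Let b_gt0 : 0 < n%:R - alpha. Proof. by case/andP: alphaP => ? ?; rewrite subr_gt0. Qed.

Let n_gt0 : (0 < n)%N.
Proof. by case/andP: alphaP => a0 /(lt_trans a0); rewrite ltr0n. Qed.

Let r_gt1 : 1 < r.
Proof.
rewrite rE ltr_pdivlMr// mul1r ltrBlDr ltrDl.
by case/andP: alphaP.
Qed.

(** A zero base to a nonzero power is 0 and the inverse of 0 is 0, so the arbitrary value of [Omega]
    at the origin disappears from the kernel. *)
Lemma kernel0 : kernel 0 = 0.
Proof. by rewrite /kernel enorm0 powR0 ?gt_eqF// invr0 mulr0. Qed.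

Lemma kernelZ (t : R) x : 0 < t -> kernel (t *: x) = kernel x / t `^ (n%:R - alpha).
Proof.
move=> t0; have [->|x0] := eqVneq x 0; first by rewrite scaler0 kernel0 mul0r.
rewrite /kernel homO// enormZ ger0_norm ?ltW// powRM ?enorm_ge0 ?ltW//.
by rewrite invfM mulrA mulrAC.
Qed.

Lemma measurable_kernel : measurable_fun [set: Rn R n] (kernel : Rn R n -> R).
Proof.
have mD : measurable ([set x | x != 0] : set (Rn R n)).
  rewrite (_ : [set _ | _] = @enorm R n @^-1` `]0, +oo[%classic).
    rewrite -[X in measurable X]setTI.
    by apply: (borel_measurable_Rn (measurable_enorm (n := n))) => //; exact: measurable_itv.
  by apply/seteqP; split => x /=; rewrite in_itv/= andbT enorm_gt0.
have -> : kernel = fun x => (Omega \_ [set x | x != 0]) x *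
    enorm x `^ (- (n%:R - alpha)).
  apply/funext => x; rewrite /kernel powRN patchE.
  case: ifPn => //; rewrite notin_setE /= => /negP; rewrite negbK => /eqP ->.
  by rewrite enorm0 powR0 ?gt_eqF// invr0 !mulr0.
apply: measurable_funM.
  by apply/measurable_restrict => //; rewrite setTI.
apply: (measurableT_comp (f := fun y => y `^ _)); first exact: measurable_powR.
exact: (borel_measurable_Rn measurable_enorm).
Qed.

(* The measure of [{|kernel| > 1}]. *)
Definition kernel_const : \bar R :=
  (n%:R^-1%:E * \int[sigma]_x (`|Omega x| `^ r)%:E)%E.

Let r_gt0 : 0 < r. Proof. exact: lt_trans r_gt1. Qed.

Lemma kernel_constE :
  kernel_const = (n%:R^-1%:E * 'N[sigma]_(r%:E) [EFin \o Omega] `^ r)%E.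
Proof.
by rewrite poweR_Lnorm ?gt_eqF.
Qed.

Lemma kernel_const_ge0 : (0 <= kernel_const)%E.
Proof.
rewrite /kernel_const mule_ge0 ?lee_fin ?invr_ge0//.
by apply: integral_ge0 => x _; rewrite lee_fin powR_ge0.
Qed.

Lemma kernel_const_fin : kernel_const \is a fin_num.
Proof.
rewrite ge0_fin_numE ?kernel_const_ge0// kernel_constE.
rewrite lte_mul_pinfty ?lee_fin ?invr_ge0//; apply: poweR_lty.
by have /sub_Lfun_finLfun := LOmega; rewrite inE.
Qed.

Let measurable_Omega_Sn : measurable_fun setT (Omega : Sn R n -> R).
Proof. by have /sub_Lfun_mfun := LOmega; rewrite inE. Qed.

(** Raising [|x|^(n - alpha) < |Omega x| / u] to the power [r] produces [|x|^n] on the left, so the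
    level set is the hypograph of [(|Omega| / u)^r]. *)
Lemma lebesgueRn_kernel_gt (u : R) : 0 < u ->
  m [set x | u < `|kernel x|] = ((u `^ r)^-1%:E * kernel_const)%E.
Proof.
move=> u0; pose g x := (`|Omega x| / u) `^ r.
have g0 x : 0 <= g x by exact: powR_ge0.
have mg : measurable_fun setT (g : Sn R n -> R).
  apply: (measurableT_comp (f := fun y => y `^ r)); first exact: measurable_powR.
  apply: measurable_funM; last exact: measurable_cst.
  exact: (measurableT_comp (@normr_measurable R setT) measurable_Omega_Sn).
have -> : [set x | u < `|kernel x|] = hypograph g.
  have xP x : x != 0 -> (u < `|kernel x|) = (enorm x ^+ n < g ((enorm x)^-1 *: x)).
    move=> x0; have ex : 0 < enorm x by rewrite enorm_gt0.
    rewrite /g homO ?invr_gt0// /kernel normrM [in X in _ * X]ger0_norm; last first.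
      by rewrite invr_ge0 powR_ge0.
    rewrite ltr_pdivlMr ?powR_gt0// mulrC -ltr_pdivlMr//.
    rewrite -(powR_mulrn n (ltW ex)).
    have nE : n%:R = (n%:R - alpha) * r by rewrite rE mulrC divfK// gt_eqF.
    by rewrite [in RHS]nE powRrM ltr_powRn2r ?powR_ge0// divr_ge0// ltW.
  apply/seteqP; split => x.
    rewrite /= => uK; have x0 : x != 0.
      by apply: contraTneq uK => ->; rewrite kernel0 normr0 -leNgt ltW.
    by split; [rewrite enorm_gt0|rewrite -xP].
  by move=> [ex xg]; rewrite /= xP// -enorm_gt0.
rewrite (lebesgueRn_hypograph n_gt0 mg g0).2 /kernel_const muleCA; congr (_ * _)%E.
have mOr : measurable_fun setT (fun x : Sn R n => (`|Omega x| `^ r)%:E).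
  apply/measurable_EFinP.
  apply: (measurableT_comp (f := fun y => y `^ r)); first exact: measurable_powR.
  exact: (measurableT_comp (@normr_measurable R setT) measurable_Omega_Sn).
rewrite -ge0_integralZl; first last.
- by rewrite lee_fin invr_ge0 powR_ge0.
- by move=> x _; rewrite lee_fin powR_ge0.
- exact: mOr.
- exact: measurableT.
apply: eq_integral => x _; rewrite -[RHS]EFinM; congr EFin.
rewrite /g powRM ?invr_ge0 ?(ltW u0)// mulrC; congr (_ * _).
by rewrite -(powR_inv1 (ltW u0)) -powRrM mulN1r powRN.
Qed.
End kernel.

Lemma le_truncateB (R : realType) (T : Type) (e : R) (h : T -> R) (x y : T) :
  0 <= e -> `|h x - h y| <= `|truncate e h x - truncate e h y| + 2 * e.
Proof.
move=> e0.
have le_e z : `|h z - truncate e h z| <= e.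
  rewrite /truncate; case: ltP => hz; first by rewrite subrr normr0.
  by rewrite subr0.
rewrite (_ : h x - h y = (truncate e h x - truncate e h y) +
  ((h x - truncate e h x) - (h y - truncate e h y))); last by ring.
rewrite (le_trans (ler_normD _ _))// lerD2l (le_trans (ler_normB _ _))//.
by rewrite mulr_natl mulr2n lerD.
Qed.

(** * Pointwise comparison of the dilated integral with the kernel *)

Section pointwise.
Context {R : realType} {n : nat}.
Variables (K f : 'rV[R]_n -> R) (s : nat -> R) (c : R).
Local Notation mu := (@lebesgue_borel R n).
Local Open Scope ereal_scope.
Hypothesis mK : measurable_fun [set: RV R n] (K : RV R n -> R).
Hypothesis iF : mu.-integrable setT (EFin \o f).
Hypothesis intf : \int[mu]_x (f x)%:E = c%:E.
Hypothesis intnf : \int[mu]_x `|(f x)%:E| = c%:E.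

(** The part of [K] below height [d] costs at most [2 d |f y|] in the integrand, so [D] is
    integrable; adding [K x] times [f], where [K x] is constant in [y], gives absolute convergence
    as well as the estimate. Hence at such [x] the value of the integral is not a convention. *)
Lemma convolution_close (d e : R) k (x : 'rV[R]_n) : (0 < d)%R ->
  mu.-integrable setT (EFin \o truncate d K) ->
  convolution_error (truncate d K) f s k x < e%:E ->
  mu.-integrable setT (fun y => (K (x - s k *: y) * f y)%:E) /\
  exists2 v, \int[mu]_y (K (x - s k *: y) * f y)%:E = v%:E &
    (`|v - c * K x| <= e + 2 * d * c)%R.
Proof.
move=> d0 iKd He.
have mf : measurable_fun [set: RV R n] f.
  by apply/measurable_EFinP; exact: measurable_int iF.
have msub : measurable_fun [set: RV R n]
    ((fun y : 'rV[R]_n => (x - s k *: y)%R) : RV R n -> RV R n).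
  apply: measurable_fun_rV => i; under eq_fun do rewrite !mxE.
  apply: measurable_funB; first exact: measurable_cst.
  by apply: measurable_funM; [exact: measurable_cst|exact: measurable_coord].
pose D y := ((K (x - s k *: y) - K x) * f y)%R.
have mD : measurable_fun [set: RV R n] (D : RV R n -> R).
  apply: measurable_funM => //; apply: measurable_funB; last exact: measurable_cst.
  exact: (measurableT_comp mK msub).
pose E y := ((truncate d K (x - s k *: y) - truncate d K x) * f y)%R.
have mKd : measurable_fun [set: RV R n] (truncate d K : RV R n -> R).
  by apply/measurable_EFinP; exact: measurable_int iKd.
have mE : measurable_fun [set: RV R n] (fun y : RV R n => `|(E y)%:E|).
  apply: measurableT_comp => //; apply/measurable_EFinP; apply: measurable_funM => //.
  apply: measurable_funB; last exact: measurable_cst.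
  exact: (measurableT_comp mKd msub).
have DE y : `|(D y)%:E| <= `|(E y)%:E| + (2 * d)%:E * `|(f y)%:E|.
  rewrite -EFinM -EFinD lee_fin /D /E !normrM -mulrDl ler_wpM2r//.
  exact/le_truncateB/ltW.
have mnf : measurable_fun [set: RV R n] (fun y : RV R n => `|(f y)%:E|).
  by apply: measurableT_comp => //; exact/measurable_EFinP.
have D_le : \int[mu]_y `|(D y)%:E| <= (e + 2 * d * c)%:E.
  apply: (@le_trans _ _ (\int[mu]_y (`|(E y)%:E| + (2 * d)%:E * `|(f y)%:E|))).
    apply: ge0_le_integral => //.
    - by apply: measurableT_comp => //; exact/measurable_EFinP.
    - by apply: emeasurable_funD => //; exact: measurable_funeM.
  rewrite ge0_integralD//; last 2 first.
  - by move=> y _; rewrite mule_ge0// lee_fin ltW// mulr_gt0.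
  - exact: measurable_funeM.
  rewrite ge0_integralZl//; last by rewrite lee_fin ltW// mulr_gt0.
  by rewrite intnf EFinD [in leRHS]EFinM leeD2r// ltW.
have iD : mu.-integrable setT (EFin \o D).
  apply/integrableP; split; first exact/measurable_EFinP.
  by apply: le_lt_trans D_le _; rewrite ltry.
have KfE y : (K (x - s k *: y) * f y)%:E = (D y)%:E + (K x)%:E * (f y)%:E.
  by rewrite -EFinM -EFinD /D; congr EFin; ring.
have iKxf : mu.-integrable setT (fun y => (K x)%:E * (f y)%:E).
  exact: (integrableZl measurableT _ iF).
have iKf : mu.-integrable setT (fun y => (K (x - s k *: y) * f y)%:E).
  by under eq_fun do rewrite KfE; exact: integrableD.
split => //.
have : `|\int[mu]_y (D y)%:E| <= (e + 2 * d * c)%:E.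
  by apply: le_trans D_le; apply: le_abse_integral => //; exact/measurable_EFinP.
have Dfin : \int[mu]_y (D y)%:E \is a fin_num by exact: integrable_fin_num iD.
rewrite -(fineK Dfin) => vle; exists (fine (\int[mu]_y (D y)%:E) + K x * c)%R.
  under eq_integral do rewrite KfE.
  rewrite (integralD measurableT iD iKxf) (integralZl measurableT iF).
  by rewrite [X in _ + _ * X]intf EFinD EFinM fineK.
by rewrite -lee_fin (mulrC (K x)) addrK.
Qed.
End pointwise.

(** * The level sets of the fractional integral *)

Lemma cvge_EFin_dist_le (R : realType) (u : nat -> \bar R) (l : R) :
  (forall e : R, 0 < e ->
    \forall k \near \oo, ((l - e)%:E <= u k <= (l + e)%:E)%E) ->
  u @ \oo --> l%:E.
Proof.
move=> ul.
have fin e k : ((l - e)%:E <= u k <= (l + e)%:E)%E -> u k \is a fin_num.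
  by case: (u k) => // /andP[].
apply/fine_cvgP; split; first by apply: filterS (ul 1 ltr01) => k; exact: fin.
apply/cvgrPdist_le => e e0; apply: filterS (ul e e0) => k uk.
have := fin _ _ uk; rewrite /=; case: (u k) uk => //= a.
by rewrite !lee_fin ler_distlC.
Qed.

Lemma norm_gt_dist_le (R : realType) (v w t a a' : R) :
  `|v - w| <= t -> a + t <= a' -> a' < `|v| -> a < `|w|.
Proof.
move=> vw aa' av; have := ler_normD (v - w) w; rewrite subrK => vle.
rewrite -(ltrD2r t); apply: le_lt_trans aa' _; apply: lt_le_trans av _.
by apply: le_trans vle _; rewrite addrC lerD2l.
Qed.

Lemma ae_ge0_integral_abse d (T : measurableType d) (R : realType)
    (mu : {measure set T -> \bar R}) (f : T -> R) :
  measurable_fun setT f -> {ae mu, forall x, 0 <= f x} ->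
  (\int[mu]_x (f x)%:E = \int[mu]_x `|(f x)%:E|)%E.
Proof.
move=> mf [Z [mZ Z0 fZ]]; apply: ae_eq_integral; first exact: measurableT.
- exact/measurable_EFinP.
- by apply: measurableT_comp => //; exact/measurable_EFinP.
exists Z; split; [exact: mZ|exact: Z0|].
move=> x nfx; apply: fZ => /= fx; apply: nfx => _.
by rewrite gee0_abs// lee_fin.
Qed.

Section dilation.
Context {R : realType} {n : nat}.
Variables (alpha r : R) (f Omega : 'rV[R]_n -> R).
Hypothesis alphaP : 0 < alpha < n%:R.
Hypothesis rE : r = n%:R / (n%:R - alpha).
Hypothesis iF : (lebesgueRn R n).-integrable setT (EFin \o f).
Hypothesis f_ge0 : {ae lebesgueRn R n, forall x, 0 <= f x}.
Hypothesis mOmega :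
  measurable_fun ([set x | x != 0] : set (Rn R n)) (Omega : Rn R n -> R).
Hypothesis homO : forall (t : R) (x : 'rV[R]_n), 0 < t -> x != 0 ->
  Omega (t *: x) = Omega x.
Hypothesis LOmega : (Omega : Sn R n -> R) \in Lfun (surface_measure R n) r%:E.
Local Notation m := (lebesgueRn R n).
Local Notation mu := (@lebesgue_borel R n).
Local Notation K := (kernel alpha Omega).
Local Notation b := (n%:R - alpha).

Variables (c A : R).
Hypothesis cE : (\int[m]_x `|(f x)%:E|)%E = c%:E.
Hypothesis AE : kernel_const r Omega = A%:E.

Let b_gt0 : 0 < b. Proof. by case/andP: alphaP => ? ?; rewrite subr_gt0. Qed.

Let r_gt1 : 1 < r.
Proof. by rewrite rE ltr_pdivlMr// mul1r ltrBlDr ltrDl; case/andP: alphaP. Qed.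

Let r_gt0 : 0 < r. Proof. exact: lt_trans r_gt1. Qed.

Let c_ge0 : 0 <= c.
Proof. by rewrite -lee_fin -cE integral_ge0. Qed.

Let A_ge0 : 0 <= A.
Proof. by rewrite -lee_fin -AE kernel_const_ge0. Qed.

Let m_kernel_gt (u : R) : 0 < u ->
  m [set x | u < `|c * K x|] = (c `^ r * A / u `^ r)%:E.
Proof.
move=> u0; have [c0|c0] := eqVneq c 0.
  rewrite c0 powR0 ?gt_eqF// !mul0r (_ : [set x | _] = set0) ?measure0//.
  by apply/seteqP; split => // x /=; rewrite mul0r normr0 ltNge ltW.
have cp : 0 < c by rewrite lt0r c0.
rewrite (_ : [set x | _] = [set x | u / c < `|K x|]); last first.
  apply/funext => x; apply/propext; rewrite /= normrM gtr0_norm//.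
  by rewrite ltr_pdivrMr// mulrC.
rewrite (lebesgueRn_kernel_gt alphaP rE homO LOmega) ?divr_gt0// AE -EFinM.
congr EFin; rewrite powRM ?invr_ge0 ?(ltW u0) ?(ltW cp)//.
rewrite -(powR_inv1 c_ge0) -powRrM mulN1r powRN.
have := powR_gt0 r u0; have := powR_gt0 r cp => p1 p2.
by field; rewrite !gt_eqF.
Qed.

Lemma dilated_level_cvg (s : nat -> R) :
  (forall k, 0 < s k) -> s k @[k --> \oo] --> 0 ->
  m [set x |
      ((s k `^ b)%:E < `|frac_integral Omega alpha f ((s k)^-1 *: x)|)%E]
    @[k --> \oo] --> (c `^ r * A)%:E.
Proof.
move=> s_gt0 s0.
have mf : measurable_fun [set: Rn R n] (f : Rn R n -> R).
  by apply/measurable_EFinP; exact: measurable_int iF.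
have [f' [N1 [mf' mN1 N1_0 ff']]] := borel_version mf.
have [K' [N2 [mK' mN2 N2_0 KK']]] := borel_version (measurable_kernel alphaP mOmega).
have mN1' : m N1 = 0%E by rewrite -N1_0; exact: lebesgueRnE.
have mN2' : m N2 = 0%E by rewrite -N2_0; exact: lebesgueRnE.
have intnf : (\int[mu]_x `|(f' x)%:E| = c%:E)%E.
  rewrite -cE; apply/esym; apply: (ae_integral_borel _ mN1').
    by apply: measurableT_comp => //; exact/measurable_EFinP.
  by move=> x /ff' ->.
have intf : (\int[mu]_x (f' x)%:E = c%:E)%E.
  rewrite -cE -(ae_ge0_integral_abse mf f_ge0).
  apply/esym; apply: (ae_integral_borel _ mN1'); first exact/measurable_EFinP.
  by move=> x /ff' ->.
have iF' : mu.-integrable setT (EFin \o f').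
  apply/integrableP; split; first exact/measurable_EFinP.
  by rewrite [ltLHS]intnf ltry.
have weakK' (u : R) : 0 < u -> (mu [set x | (u < `|K' x|)%R] <= (A / u `^ r)%:E)%E.
  move=> u0; have mS : measurable ([set x | u < `|K' x|] : set (RV R n)).
    rewrite (_ : [set x | _] = setT `&` (fun x => `|K' x|) @^-1` `]u, +oo[%classic).
      have mnK : measurable_fun [set: RV R n] (fun x => `|K' x|).
        exact: (measurableT_comp (@normr_measurable R setT) mK').
      by apply: mnK => //; exact: measurable_itv.
    by apply/seteqP; split => x /=; rewrite in_itv/= andbT; [move=> ?; split|case].
  have := lebesgueRnE mS => <-.
  apply: (@le_trans _ _ (m ([set x | u < `|K x|] `|` N2))).
    apply: le_lebesgueRn => x /= uK; have [?|nN] := pselect (N2 x); first by right.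
    by left; rewrite -KK'.
  apply: le_trans (lebesgueRnU2 _ _) _.
  rewrite mN2' adde0 (lebesgueRn_kernel_gt alphaP rE homO LOmega)// AE -EFinM.
  by rewrite mulrC.
pose P k := [set x |
  ((s k `^ b)%:E < `|frac_integral Omega alpha f ((s k)^-1 *: x)|)%E].
pose N := N1 `|` N2.
have close (d e : R) k (x : 'rV[R]_n) : 0 < d -> ~ N x ->
   (convolution_error (truncate d K') f' s k x < e%:E)%E ->
   exists2 v, frac_integral Omega alpha f ((s k)^-1 *: x) = (s k `^ b * v)%:E &
     `|v - c * K x| <= e + 2 * d * c.
  move=> d0 nNx He.
  have iKd := integrable_truncate mK' r_gt1 d0 weakK'.
  have [iKf [v vE vle]] := convolution_close mK' iF' intf intnf d0 iKd He.
  exists v; last by rewrite -KK'// => ?; apply: nNx; right.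
  (* The set of [y] where a Borel version differs from the original in the integrand at this [x]. It
     depends on [x], but it is null for every [x], as the affine preimage of a null set is null. *)
  pose N' := (affine (- s k) x @^-1` N2) `|` N1.
  have sk0 : - s k != 0 by rewrite oppr_eq0 gt_eqF.
  have N'0 : m N' = 0%E.
    apply/eqP; rewrite eq_le measure_ge0 andbT.
    apply: le_trans (lebesgueRnU2 _ _) _; rewrite mN1' adde0.
    have skn : (0 < `|- s k| ^+ n)%R by rewrite exprn_gt0// normr_gt0.
    rewrite -(@lee_pmul2l _ (`|- s k| ^+ n)%:E)// lebesgueRn_affine//.
    by rewrite mN2' mule0.
  (* No change of variables in [y] is made: [x / s - y] is [(x - s y) / s], and homogeneity of the
     kernel takes out the factor [s^(n - alpha)]. *)
  have E : frac_integral Omega alpha f ((s k)^-1 *: x) =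
      (\int[mu]_y ((s k `^ b)%:E * (K' (x - s k *: y) * f' y)%:E))%E.
    apply: (ae_integral_borel _ N'0).
      by apply: measurable_funeM; exact: measurable_int iKf.
    move=> y nN'; rewrite -EFinM; congr EFin; rewrite ff'; last first.
      by move=> ?; apply: nN'; right.
    rewrite KK'; last first.
      by move=> ?; apply: nN'; left; rewrite /= /affine addrC scaleNr.
    rewrite mulrA; congr (_ * _).
    have -> : (s k)^-1 *: x - y = (s k)^-1 *: (x - s k *: y).
      by rewrite scalerBr scalerA mulVf ?scale1r// gt_eqF.
    have := kernelZ alphaP homO (x - s k *: y) (_ : 0 < (s k)^-1).
    rewrite invr_gt0 => /(_ (s_gt0 k)); rewrite {1}/kernel => ->.
    rewrite -(powR_inv1 (ltW (s_gt0 k))) -powRrM mulN1r powRN invrK mulrC.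
    by [].
  by rewrite E (integralZl measurableT iKf) vE.
apply: cvge_EFin_dist_le => e e0.
have L_ge0 : 0 <= c `^ r * A by rewrite mulr_ge0 ?powR_ge0.
(* Half of [e] pays for moving the level of [c K] away from 1, the other half for the exceptional
   set [B k]. The bound [1 / 2] keeps [1 - e'] positive, and the added 1 avoids a zero
   denominator. *)
have [e' [e'0 e'1 e'L]] : exists e' : R,
    [/\ 0 < e', e' < 1 & c `^ r * A * e' <= e / 2].
  exists (Num.min (1 / 2) (e / 2 / (c `^ r * A + 1))).
  have L1 : 0 < c `^ r * A + 1 by rewrite ltr_wpDl.
  split; rewrite ?lt_min ?gt_min ?divr_gt0//.
    by rewrite ltr_pdivrMr// mul1r ltr1n.
  apply: le_trans (_ : (c `^ r * A + 1) * (e / 2 / (c `^ r * A + 1)) <= _); last first.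
    by rewrite mulrC divfK// gt_eqF.
  by apply: ler_pM => //; rewrite ?lerDl// ?ge_min ?lexx ?orbT// le_min !divr_ge0// ltW.
(* At the levels [u1 < 1 < u2] the distribution function of [c K] equals
   [(1 + e') c^r A] and [(1 - e') c^r A]. *)
pose u1 := (1 + e') `^ (- r^-1); pose u2 := (1 - e') `^ (- r^-1).
have p1 : 0 < 1 + e' by rewrite addr_gt0.
have p2 : 0 < 1 - e' by rewrite subr_gt0.
have u1_gt0 : 0 < u1 by exact: powR_gt0.
have u2_gt0 : 0 < u2 by exact: powR_gt0.
have u1r : u1 `^ r = (1 + e')^-1.
  by rewrite -powRrM mulNr mulVf ?gt_eqF// powR_inv1// ltW.
have u2r : u2 `^ r = (1 - e')^-1.
  by rewrite -powRrM mulNr mulVf ?gt_eqF// powR_inv1// ltW.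
have u1_lt1 : u1 < 1.
  rewrite -(ltr_powRn2r r_gt0) ?(ltW u1_gt0)// u1r powR1.
  by rewrite invf_lt1// ltrDl.
have u2_gt1 : 1 < u2.
  rewrite -(ltr_powRn2r r_gt0) ?(ltW u2_gt0)// u2r powR1.
  by rewrite invf_gt1// gtrBl.
pose eta := Num.min (1 - u1) (u2 - 1).
have eta_gt0 : 0 < eta by rewrite lt_min !subr_gt0 u1_lt1.
have eta1 : eta <= 1 - u1 by rewrite ge_min lexx.
have eta2 : eta <= u2 - 1 by rewrite ge_min lexx orbT.
have c1 : 0 < 4 * (c + 1) by rewrite mulr_gt0// ltr_wpDl.
(* This makes [2 d c] at most [eta / 2], also when [c = 0]; the other half of [eta] is the threshold
   defining [B k]. *)
pose d := eta / (4 * (c + 1)).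
have d0 : 0 < d by exact: divr_gt0.
have eta_close : eta / 2 + 2 * d * c <= eta.
  have -> : 2 * d * c = eta / 2 * (c / (c + 1)).
    by rewrite /d; field; rewrite gt_eqF// ltr_wpDl.
  rewrite [leRHS]splitr lerD2l ler_piMr ?divr_ge0 ?(ltW eta_gt0)//.
  by rewrite ler_pdivrMr ?ltr_wpDl// mul1r lerDl.
have iKd := integrable_truncate mK' r_gt1 d0 weakK'.
have eta2_gt0 : 0 < eta / 2 by exact: divr_gt0.
pose B k := [set x |
  ((eta / 2)%:E <= convolution_error (truncate d K') f' s k x)%E].
have B0 : mu (B k) @[k --> \oo] --> 0%E by exact: convolution_error_cvg0.
have N0 : m N = 0%E.
  apply/eqP; rewrite eq_le measure_ge0 andbT.
  by apply: le_trans (lebesgueRnU2 _ _) _; rewrite mN1' mN2' adde0.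
have mBk k : m (B k) = mu (B k).
  apply: lebesgueRnE; rewrite -[X in measurable X]setTI.
  apply: emeasurable_fun_c_infty => //.
  exact: measurable_convolution_error iKd iF' _.
have near_P k x : ~ N x -> ~ B k x ->
    exists2 v, frac_integral Omega alpha f ((s k)^-1 *: x) = (s k `^ b * v)%:E &
      `|v - c * K x| <= eta.
  move=> nN /negP; rewrite -ltNge => Bx.
  by have [v ? vle] := close _ _ _ _ d0 nN Bx; exists v => //; apply: le_trans vle _.
have PE k x v : frac_integral Omega alpha f ((s k)^-1 *: x) = (s k `^ b * v)%:E ->
    ((s k `^ b)%:E < `|frac_integral Omega alpha f ((s k)^-1 *: x)|)%E = (1 < `|v|).
  move=> ->; rewrite abse_EFin lte_fin normrM gtr0_norm ?powR_gt0//.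
  by rewrite -[ltLHS]mulr1 ltr_pM2l// powR_gt0.
(* Outside [N] and [B k] the rescaled integral differs from [c K x] by at most [eta], which is no
   more than the distance from 1 to [u1] or [u2]. This sandwiches [P k] between two level sets of
   [c K], up to the exceptional sets. *)
have P_sub k : P k `<=` [set x | u1 < `|c * K x|] `|` (N `|` B k).
  move=> x Px; have [Nx|Nx] := pselect (N x); first by right; left.
  have [Bx|Bx] := pselect (B k x); first by right; right.
  left; have [v vE vle] := near_P k x Nx Bx.
  move: Px; rewrite /P /= (PE _ _ _ vE) => v1.
  by apply: norm_gt_dist_le vle _ v1; rewrite -lerBrDl.
have sub_P k : [set x | u2 < `|c * K x|] `<=` P k `|` (N `|` B k).
  move=> x /= u2x; have [Nx|Nx] := pselect (N x); first by right; left.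
  have [Bx|Bx] := pselect (B k x); first by right; right.
  left; have [v vE vle] := near_P k x Nx Bx.
  rewrite /P /= (PE _ _ _ vE); rewrite distrC in vle.
  by apply: norm_gt_dist_le vle _ u2x; rewrite -lerBrDl.
have mNB k : (m (N `|` B k) <= mu (B k))%E.
  by apply: le_trans (lebesgueRnU2 _ _) _; rewrite N0 add0e mBk.
have e2 : 0 < e / 2 by exact: divr_gt0.
have [j _ Bj] := (ge0_cvge0P (fun k => measure_ge0 mu (B k))).1 B0 _ e2.
exists j => // k /Bj /= Bk; apply/andP; split.
- have := le_lebesgueRn (sub_P k).
  rewrite m_kernel_gt// u2r invrK => le2.
  have le3 : ((c `^ r * A * (1 - e'))%:E <= m (P k) + (e / 2)%:E)%E.
    apply: le_trans le2 _; apply: le_trans (lebesgueRnU2 _ _) _.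
    by apply: leeD2l; apply: le_trans (mNB k) _.
  rewrite -leeBlDr// in le3; apply: le_trans le3; rewrite -EFinB lee_fin.
  by rewrite mulrBr mulr1 -addrA lerD2l -opprD lerN2 [leRHS]splitr lerD2r.
- apply: le_trans (le_lebesgueRn (P_sub k)) _.
  apply: le_trans (lebesgueRnU2 _ _) _.
  rewrite m_kernel_gt// u1r invrK (splitr e) addrA EFinD.
  apply: leeD; last exact: le_trans (mNB k) _.
  by rewrite lee_fin mulrDr mulr1 lerD2l.
Qed.
End dilation.

Theorem corollary1p6 (R : realType) (n : nat) (alpha r : R)
    (f : 'rV[R]_n -> R) (Omega : 'rV[R]_n -> R) :
  0 < alpha < n%:R ->
  r = n%:R / (n%:R - alpha) ->
  (lebesgueRn R n).-integrable setT (EFin \o f) ->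
  {ae lebesgueRn R n, forall x, 0 <= f x} ->
  measurable_fun ([set x | x != 0] : set (Rn R n)) (Omega : Rn R n -> R) ->
  (forall (lambda : R) (x : 'rV[R]_n), 0 < lambda -> x != 0 ->
     Omega (lambda *: x) = Omega x) ->
  (\int[surface_measure R n]_(theta in usphere R n) (Omega theta)%:E = 0)%E ->
  Dini r%:E alpha Omega ->
  ((lambda `^ r)%:E *
     lebesgueRn R n [set x | lambda%:E < `|frac_integral Omega alpha f x|])%E
    @[lambda --> 0^'+] -->
  ((n%:R^-1)%:E *
     'N[surface_measure R n]_(r%:E) [EFin \o Omega] `^ r *
     'N[lebesgueRn R n]_1 [EFin \o f] `^ r)%E.
Proof.
move=> alphaP rE iF f_ge0 mOmega homO _ [LOmega _].
have /andP[_ alphan] := alphaP.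
have b_gt0 : 0 < n%:R - alpha by rewrite subr_gt0.
have [c cE] : exists c, (\int[lebesgueRn R n]_x `|(f x)%:E| = c%:E)%E.
  exists (fine (\int[lebesgueRn R n]_x `|(f x)%:E|)).
  rewrite fineK// ge0_fin_numE ?integral_ge0//.
  by have /integrableP[] := iF.
have [A AE] : exists A, kernel_const r Omega = A%:E.
  exists (fine (kernel_const r Omega)).
  by rewrite fineK//; apply: kernel_const_fin alphaP rE LOmega.
rewrite -(kernel_constE Omega alphaP rE) Lnorm1 cE poweR_EFin AE -EFinM mulrC.
(* The limit is tested along sequences, to which dominated convergence applies. *)
apply/cvge_at_rightP => lam [lam_gt0 lam0].
pose s k := lam k `^ (n%:R - alpha)^-1.
have s_gt0 k : 0 < s k by exact: powR_gt0.
have s0 : s k @[k --> \oo] --> 0.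
  have bV_gt0 : 0 < (n%:R - alpha)^-1 by rewrite invr_gt0.
  by apply: ((cvg_at_rightP _ _ _).1 (powR_cvg0 bV_gt0)).
have sb k : s k `^ (n%:R - alpha) = lam k.
  by rewrite -powRrM mulVf ?gt_eqF// powRr1// ltW.
have := dilated_level_cvg alphaP rE iF f_ge0 mOmega homO LOmega cE AE s_gt0 s0.
set F := (F in F @ \oo --> _ -> _); set G := (G in _ -> G @ \oo --> _).
suff -> : F = G by [].
apply/funext => k; rewrite /F /G {F G}.
have sk0 : (s k)^-1 != 0 by rewrite invr_eq0 gt_eqF.
(* Here [s^n = lambda^(n / (n - alpha)) = lambda^r], so the normalization cancels the Jacobian of
   the dilation. *)
have sn : lam k `^ r * `|(s k)^-1| ^+ n = 1.
  rewrite gtr0_norm ?invr_gt0// exprVn -powR_mulrn ?ltW// -powRrM.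
  by rewrite rE (mulrC _^-1) mulfV// gt_eqF// powR_gt0.
pose S := [set x | ((lam k)%:E < `|frac_integral Omega alpha f x|)%E].
have mS : lebesgueRn R n S =
    ((`|(s k)^-1| ^+ n)%:E * lebesgueRn R n (affine (s k)^-1 0 @^-1` S))%E.
  by have := lebesgueRn_affine 0 S sk0 => ->.
transitivity ((lam k `^ r)%:E *
    ((`|(s k)^-1| ^+ n)%:E * lebesgueRn R n (affine (s k)^-1 0 @^-1` S)))%E.
  rewrite muleA -EFinM sn mul1e; apply: (congr1 (lebesgueRn R n)).
  by apply/funext => x; rewrite /S /= sb /affine addr0.
by congr (_ * _)%E; exact: esym mS.
Qed.
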